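(* For all integers $r,s\ge 0$, $$\frac{Z_{(1^r),(1^s)}(Q;q,t)}{Z_{\emptyset,\emptyset}(Q;q,t)}=g_{1^r}\,g_{1^s}\;e_r(Qt^\rho,t^{-\rho})\;e_s(Qq^{(1^r)}t^\rho,t^{-\rho}),\qquad g_{1^r}:=(-1)^rt^{-r(r-1)/2},$$ which is a polynomial of degree $r+s$ in $Q$.
   Context: A partition $\eta=(\eta_1\ge\eta_2\ge\cdots)$ has size $|\eta|$, conjugate $\eta^\vee$ and length $\ell(\eta)=\eta^\vee_1$; $(i,j)\in\eta$ means $1\le j\le\eta_i$; $(1^r)$ is the partition with $r$ parts equal to $1$; $\emptyset$ is the empty partition. $q,t$ (and $t^{1/2}$) are indeterminates. Symmetric functions are regarded as polynomials in the power sums $p_n$ and evaluated by specializing the $p_n$. For a partition $\eta$ and scalars $c,L$, $f(cq^\eta t^\rho,Lt^{-\rho})$ denotes the value of $f$ when $$p_n\mapsto p_n(cq^\eta t^\rho,Lt^{-\rho}):=c^n\sum_{i=1}^{\ell(\eta)}(q^{n\eta_i}-1)t^{n(\frac12-i)}+\frac{c^n-L^n}{t^{n/2}-t^{-n/2}},$$ and $f(q^\eta t^\rho)$ is the case $c=1$, $L=0$ (and $f(ct^\rho,Lt^{-\rho})$ the case $\eta=\emptyset$). $e_r$ is the elementary symmetric function, $\sum_r w^re_r=\exp\{-\sum_{n>0}\frac{(-w)^n}{n}p_n\}$, and $s_\lambda$ the Schur function. Define the formal power series in $Q$ $$Z_{\lambda,\mu}(Q;q,t):=\sum_\eta s_\lambda(q^\eta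 t^\rho)\,s_\mu(q^\eta t^\rho)\prod_{(i,j)\in\eta}\frac{Q}{(1-q^{\eta_i-j+1}t^{\eta^\vee_j-i})(1-q^{-\eta_i+j}t^{-\eta^\vee_j+i-1})},$$ the sum being over all partitions $\eta$. *)

(* Defs.v *)
From HB Require Import structures.
From mathcomp Require Import all_boot all_order all_algebra.

Set Implicit Arguments.
Unset Strict Implicit.
Unset Printing Implicit Defensive.

Import Order.TTheory GRing.Theory.
Local Open Scope ring_scope.

(* Formal power series in one variable, as coefficient sequences. *)
Section PowerSeries.
Variable A : comNzRingType.
Implicit Types f g : nat -> A.

Definition fps_one : nat -> A := fun n => (n == 0)%:R.
Definition fps_mul f g : nat -> A := fun n => \sum_(i < n.+1) f i * g (n - i)%N.
Definition fps_pow f k : nat -> A := iter k (fps_mul f) fps_one.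

End PowerSeries.

(* exp f = \sum_k f^k / k!, for f without constant term: then f^k does not
   contribute to the n-th coefficient when n < k. *)
Definition fps_exp (K : fieldType) (A : comAlgType K) (f : nat -> A) : nat -> A :=
  fun n => \sum_(k < n.+1) (k`!%:R : K)^-1 *: fps_pow f k n.

Section PowerSeriesQuotient.
Variable K : fieldType.
Implicit Types f g : nat -> K.

(* 1 / g = g_0^-1 * \sum_k (1 - g / g_0)^k, meaningful only if g_0 != 0;
   see fps_mulV below. *)
Definition fps_inv g : nat -> K :=
  fun n => (g 0%N)^-1 *
    \sum_(k < n.+1) fps_pow (fun m => fps_one K m - (g 0%N)^-1 * g m) k n.
Definition fps_div f g : nat -> K := fps_mul f (fps_inv g).

End PowerSeriesQuotient.

(* A partition is a nonincreasing sequence of naturals; trailing zeros are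
   allowed, and nothing below depends on them.  Parts are indexed from 1. *)
Definition part (eta : seq nat) (i : nat) : nat := nth 0%N eta i.-1.
Definition conj_part (eta : seq nat) (j : nat) : nat := count (leq j) eta.
Definition part_length (eta : seq nat) : nat := conj_part eta 1.
Definition col_part (r : nat) : seq nat := nseq r 1%N.

(* The partitions of n, each occurring once: padded with zeros to n parts. *)
Definition is_partition_of (n : nat) (eta : n.-tuple 'I_n.+1) : bool :=
  sorted geq (map val eta) && (sumn (map val eta) == n).

(* Symmetric functions, as functions of the values p n (n > 0) of the power
   sums in an arbitrary commutative algebra. *)
Section SymmetricFunctions.
Variables (K : fieldType) (A : comAlgType K) (p : nat -> A).

Definition esymf (r : nat) : A :=
  fps_exp (fun n => if n is 0 then 0 else - ((-1) ^+ n / n%:R : K) *: p n) r.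

Definition hsymf (r : nat) : A :=
  fps_exp (fun n => if n is 0 then 0 else (n%:R : K)^-1 *: p n) r.

(* Jacobi-Trudi: s_lambda = det (h_(lambda_i - i + j)), with h_m = 0 if m < 0. *)
Definition schur (lambda : seq nat) : A :=
  \det (\matrix_(i < part_length lambda, j < part_length lambda)
    (if (i <= part lambda i.+1 + j)%N
     then hsymf (part lambda i.+1 + j - i) else 0)).

End SymmetricFunctions.

Section Refined.
(* u stands for t^(1/2). *)
Variables (K : fieldType) (q u : K).
Let t := u ^+ 2.

Section Specialization.
Variables (A : comAlgType K) (c L : A).

(* p_n (c q^eta t^rho, L t^-rho) *)
Definition psum_spec (eta : seq nat) (n : nat) : A :=
  (\sum_(1 <= i < (part_length eta).+1)
     (q ^+ (n * part eta i) - 1) * u ^ (n%:Z * (1 - 2 * i%:Z))) *: c ^+ n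
  + (u ^+ n - u ^- n)^-1 *: (c ^+ n - L ^+ n).

End Specialization.

Definition schur_spec (lambda eta : seq nat) : K :=
  schur (psum_spec (1 : K^o) 0 eta) lambda.

(* The factor of the product over the boxes of eta, without the powers of Q. *)
Definition box_weight (eta : seq nat) : K :=
  \prod_(1 <= i < (part_length eta).+1) \prod_(1 <= j < (part eta i).+1)
    ((1 - q ^ ((part eta i)%:Z - j%:Z + 1) * t ^ ((conj_part eta j)%:Z - i%:Z))
     * (1 - q ^ (- (part eta i)%:Z + j%:Z)
            * t ^ (- (conj_part eta j)%:Z + i%:Z - 1)))^-1.

(* The power series Z_(lambda, mu) in Q: one factor Q per box, so the
   coefficient of Q^n collects the partitions of n. *)
Definition Zser (lambda mu : seq nat) : nat -> K := fun n =>
  \sum_(eta : n.-tuple 'I_n.+1 | is_partition_of eta)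
    schur_spec lambda (map val eta) * schur_spec mu (map val eta)
    * box_weight (map val eta).

Definition gcol (r : nat) : K := (-1) ^+ r * t ^- (r * (r - 1))./2.

(* e_r (Q q^eta t^rho, t^-rho), as a polynomial in Q *)
Definition esym_Q (r : nat) (eta : seq nat) : {poly K} :=
  esymf (psum_spec ('X : {poly K}) 1 eta) r.

End Refined.

(* The field F(q, t^(1/2)) of rational functions in two indeterminates. *)
Section Indeterminates.
Variable F : fieldType.
Definition ratfun : fieldType := {fraction {poly {poly F}}}.
Definition q_ind : ratfun := tofrac ('X%:P).
Definition thalf_ind : ratfun := tofrac 'X.
End Indeterminates.

Section Facts.
Variable K : fieldType.
Implicit Types f g h : nat -> K.

Lemma fps_pow_eq0 f k n : f 0%N = 0 -> (n < k)%N -> fps_pow f k n = 0.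
Proof.
move=> f0; elim: k n => [//|k IHk] n ltnk.
apply: big1 => i _; have [->|i0] := eqVneq (i : nat) 0%N.
  by rewrite f0 mul0r.
have ltnik : (n - i < k)%N.
  rewrite ltn_subLR; last by rewrite -ltnS.
  by apply: leq_trans ltnk _; rewrite -add1n leq_add2r lt0n.
by transitivity (f i * 0); [congr (_ * _); apply: IHk | apply: mulr0].
Qed.

Lemma fps_mul1 f n :
  \sum_(i < n.+1) fps_one K i * f (n - i)%N = f n.
Proof.
rewrite big_ord_recl big1 ?addr0 => [|i _].
  by rewrite /fps_one eqxx mul1r subn0.
by rewrite /fps_one mul0r.
Qed.

Lemma fps_mulV g : g 0%N != 0 -> fps_mul g (fps_inv g) =1 fps_one K.
Proof.
move=> g0 n.
pose x m : K^o := fps_one K m - (g 0%N)^-1 * g m.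
have x0 : x 0%N = 0 by rewrite /x mulVf ?subrr.
have gE m : g m * (g 0%N)^-1 = fps_one K m - x m.
  by rewrite /x opprB addrC subrK mulrC.
have invE (i : 'I_n.+1) : fps_inv g (n - i)%N
    = (g 0%N)^-1 * \sum_(k < n.+1) fps_pow x k (n - i)%N.
  congr (_ * _).
  rewrite (big_ord_widen n.+1 (fun k => fps_pow x k (n - i)%N)).
    rewrite big_mkcond; apply: eq_bigr => k _; case: ifPn => //.
    by rewrite -leqNgt => /(fps_pow_eq0 x0) ->.
  by rewrite ltnS leq_subr.
transitivity (\sum_(i < n.+1) \sum_(k < n.+1)
    (fps_one K i * fps_pow x k (n - i)%N - x i * fps_pow x k (n - i)%N)).
  apply: eq_bigr => i _; rewrite invE mulrA gE mulr_sumr.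
  by apply: eq_bigr => k _; rewrite mulrBl.
rewrite exchange_big.
transitivity (\sum_(k < n.+1) (fps_pow x k n - fps_pow x k.+1 n)).
  apply: eq_bigr => k _; rewrite sumrB; congr (_ - _).
  exact: (fps_mul1 (fps_pow x k)).
rewrite -(big_mkord xpredT (fun k => fps_pow x k n - fps_pow x k.+1 n)).
rewrite (telescope_sumr_eq (fun k => - fps_pow x k n)) //; last first.
  by move=> k _; rewrite opprK addrC.
by rewrite fps_pow_eq0// oppr0 sub0r opprK.
Qed.

Lemma Zser_vac0 (q u : K) : Zser q u [::] [::] 0%N = 1.
Proof.
have partE (eta : 0.-tuple 'I_1) : is_partition_of eta = (eta == [tuple]).
  have -> : eta = [tuple] by apply: tuple0.
  by symmetry; apply: eqxx.
rewrite /Zser (big_pred1 [tuple])//.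
by rewrite /schur_spec /schur /box_weight det_mx00 big_geq// !mulr1.
Qed.

End Facts.

(* Main.v *)
Require Import Defs.
From mathcomp Require Import all_boot all_order all_algebra.
From mathcomp Require Import ring zify.

(** Adding a box in row k to a partition eta gives a partition nu, and the
    ratio of the box weights of nu and eta is a product over the rows m <> k
    of factors in the row variables x_m = q^eta_m t^(1/2-m).  This ratio is
    split as add_coef (eta, k) / rem_coef (nu, k) so that add_coef (resp.
    rem_coef) vanishes when no box can be added to (resp. removed from) row k.
    Hence any sum over pairs (eta, nu) can be evaluated either by summing over
    the boxes added to eta or over the boxes removed from nu; if the summand is
    linear in e_r of the row variables without x_k, both inner sums are given
    by Lagrange interpolation at the points -1/x_j.  The resulting two
    relations
      t^-r <e_r>_n = c_r <e_(r+1)>_(n+1) + <e_r>_(n+1),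
      q (t^-r - t^-s) <e_r e_s>_n =
        c_r <e_(r+1) e_s>_(n+1) - c_s <e_r e_(s+1)>_(n+1)
    for the coefficients <.>_n of Z, where c_r = t^(1/2) (t^-1 - t^r), determine
    all <e_r e_s>_n from <1>_n, by induction on s for r = 0 and then on r.  The claimed product satisfies the
    same relations, because e_s(Q q^(1^r) t^rho, t^-rho) satisfies two
    first-order relations under r -> r+1.  The degree in Q is exact because
    the top coefficient of e_s(Q q^(1^r) t^rho, t^-rho) is nonzero at q = 0. *)

Set Implicit Arguments.
Unset Strict Implicit.
Unset Printing Implicit Defensive.
Import Order.TTheory GRing.Theory.
Local Open Scope ring_scope.

(** * Ring laws and logarithmic derivatives of formal power series *)

Section PowerSeriesProduct.
Variable A : comNzRingType.
Implicit Types f g h : nat -> A.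

(** Transfers the ring laws of [{poly A}] to [fps_mul]: a coefficient of a product involves only
    finitely many coefficients of the factors. *)
Lemma coefM_trunc f g m n :
  (n < m)%N -> fps_mul f g n = (\poly_(i < m) f i * \poly_(i < m) g i)`_n.
Proof.
move=> ltnm; rewrite coefM; apply: eq_bigr => i _.
rewrite !coef_poly (leq_ltn_trans (leq_subr _ _) ltnm).
by rewrite (leq_ltn_trans _ ltnm) // -ltnS.
Qed.

Lemma eq_coefM (p p' r : {poly A}) n :
  (forall i, (i <= n)%N -> p`_i = p'`_i) -> (p * r)`_n = (p' * r)`_n.
Proof.
by move=> pp'; rewrite !coefM; apply: eq_bigr => i _; rewrite pp' // -ltnS.
Qed.

Lemma fps_mulC f g : fps_mul f g =1 fps_mul g f.
Proof. by move=> n; rewrite !(@coefM_trunc _ _ n.+1) // mulrC. Qed.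

Lemma fps_mulA f g h : fps_mul f (fps_mul g h) =1 fps_mul (fps_mul f g) h.
Proof.
move=> n; rewrite [LHS](@coefM_trunc _ _ n.+1) // [RHS](@coefM_trunc _ _ n.+1) //.
set F := \poly_(i < _) f i; set H := \poly_(i < _) h i.
have truncE f1 f2 i : (i <= n)%N ->
    (\poly_(j < n.+1) fps_mul f1 f2 j)`_i =
    (\poly_(j < n.+1) f1 j * \poly_(j < n.+1) f2 j)`_i.
  by move=> lein; rewrite coef_poly ltnS lein (@coefM_trunc _ _ n.+1).
rewrite (eq_coefM _ (truncE f g)) mulrC (eq_coefM _ (truncE g h)).
by congr (_`_n); rewrite mulrC mulrA.
Qed.

Lemma eq_fps_mul f f' g g' :
  f =1 f' -> g =1 g' -> fps_mul f g =1 fps_mul f' g'.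
Proof. by move=> ff' gg' n; apply: eq_bigr => i _; rewrite ff' gg'. Qed.

Lemma fps_mulr1 f : fps_mul f (fps_one A) =1 f.
Proof.
move=> n; rewrite fps_mulC /fps_mul big_ord_recl big1 ?addr0 => [|i _].
  by rewrite /fps_one eqxx mul1r subn0.
by rewrite /fps_one mul0r.
Qed.

Lemma fps_powE f k m n :
  (n < m)%N -> fps_pow f k n = ((\poly_(i < m) f i) ^+ k)`_n.
Proof.
elim: k n => [|k IHk] n ltnm; first by rewrite expr0 coef1.
rewrite exprS /fps_pow iterS -/(fps_pow f k) (coefM_trunc _ _ ltnm).
rewrite mulrC [in RHS]mulrC; apply: eq_coefM => i lein.
by rewrite coef_poly (leq_ltn_trans lein ltnm) IHk // (leq_ltn_trans lein).
Qed.

(** The truncation of [f] is a multiple of ['X], so its k-th power is a multiple of ['X^k]. *)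
Lemma fps_pow_gt f k n : f 0%N = 0 -> (n < k)%N -> fps_pow f k n = 0.
Proof.
move=> f0 ltnk; rewrite (@fps_powE _ _ n.+1) //.
have -> : \poly_(i < n.+1) f i = \poly_(i < n) f i.+1 * 'X.
  by apply/polyP => -[|i]; rewrite coefMX !coef_poly ?f0 //= ltnS.
by rewrite exprMn coefMXn ltnk.
Qed.

(* [newton g f] says that f = \sum_n f_n w^n has constant term 1 and
   logarithmic derivative \sum_n g_n w^n. *)
Definition newton g f :=
  f 0%N = 1 /\ forall n, f n.+1 *+ n.+1 = \sum_(j < n.+1) g j * f (n - j)%N.

Lemma eq_newton g g' f : g =1 g' -> newton g f -> newton g' f.
Proof.
move=> gg' [f0 fS]; split=> // n; rewrite fS; apply: eq_bigr => j _.
by rewrite gg'.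
Qed.

Lemma newton_one : newton (fun=> 0) (fps_one A).
Proof.
by split=> // n; rewrite /fps_one mul0rn big1 // => j _; rewrite mul0r.
Qed.

Lemma newton_mul g g' f f' : newton g f -> newton g' f' ->
  newton (fun j => g j + g' j) (fps_mul f f').
Proof.
move=> [f0 fS] [f'0 f'S]; split=> [|n].
  by rewrite /fps_mul big_ord1 f0 f'0 mulr1.
rewrite (@coefM_trunc _ _ n.+2) //.
set F := \poly_(i < _) f i; set F' := \poly_(i < _) f' i.
pose G := \poly_(i < n.+1) g i; pose G' := \poly_(i < n.+1) g' i.
(* A truncation satisfies the differential equation only up to degree [n], which is enough for the
   Leibniz rule in that degree. *)
have truncS (h hh : nat -> A) (i : nat) : (forall n, h n.+1 *+ n.+1 =
      \sum_(j < n.+1) hh j * h (n - j)%N) -> (i <= n)%N ->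
    (\poly_(j < n.+2) h j)^`()`_i =
      (\poly_(j < n.+1) hh j * \poly_(j < n.+2) h j)`_i.
  move=> hS lein; rewrite coef_deriv coef_poly ltnS ltnS lein hS coefM.
  apply: eq_bigr => j _; rewrite !coef_poly.
  rewrite (leq_trans (ltn_ord j)) ?ltnS // (leq_trans (leq_subr _ _)) //.
  exact: leq_trans lein _.
rewrite -coef_deriv derivM coefD (eq_coefM _ (fun i => truncS f g i fS)).
rewrite [in X in _ + X]mulrC (eq_coefM _ (fun i => truncS f' g' i f'S)).
transitivity (((G + G') * (F * F'))`_n).
  have -> : (G + G') * (F * F') = G * F * F' + G' * F' * F by ring.
  by rewrite coefD.
rewrite coefM; apply: eq_bigr => j _.
rewrite coefD !coef_poly ltn_ord (@coefM_trunc _ _ n.+2) //.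
by rewrite ltnS (leq_trans (leq_subr _ _)).
Qed.

End PowerSeriesProduct.

(** * Exponentials and uniqueness of a series with given logarithmic derivative *)

Section SymmetricFunctions.
Variables (K : fieldType) (A : comAlgType K).
Hypothesis charK0 : [pchar K] =i pred0.
Implicit Types (f g p : nat -> A).

Lemma natS_neq0 n : n.+1%:R != 0 :> K.
Proof. by have /pcharf0P -> := charK0. Qed.

Lemma mulrnS_inj (a b : A) n : a *+ n.+1 = b *+ n.+1 -> a = b.
Proof.
move=> ab; have /(congr1 ( *:%R n.+1%:R^-1 : A -> A)) := ab.
by rewrite -!scaler_nat !scalerA mulVf ?natS_neq0 // !scale1r.
Qed.

(** The recursion fixes [f n.+1 *+ n.+1], and characteristic 0 permits division by [n.+1].
    Identities between generating series below are proved by comparing logarithmic derivatives. *)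
Lemma newton_uniq g f f' : newton g f -> newton g f' -> f =1 f'.
Proof.
move=> [f0 fS] [f'0 f'S]; elim/ltn_ind=> -[|n] IHn; first by rewrite f0 f'0.
apply: (@mulrnS_inj _ _ n); rewrite fS f'S; apply: eq_bigr => j _.
by rewrite IHn // ltnS leq_subr.
Qed.

Lemma newton_exp f : f 0%N = 0 ->
  newton (fun j => f j.+1 *+ j.+1) (fps_exp f).
Proof.
move=> f0; split=> [|n].
  by rewrite /fps_exp big_ord1 fact0 invr1 scale1r.
pose p := \poly_(i < n.+2) f i.
(* Since [p ^+ k] has no coefficient below degree [k], the sums over [k] can share one upper
   bound. *)
have expE i m : (i <= m <= n.+1)%N ->
    fps_exp f i = \sum_(k < m.+1) (k`!%:R : K)^-1 *: (p ^+ k)`_i.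
  move=> /andP[leim lemn]; rewrite /fps_exp.
  rewrite (big_ord_widen m.+1 (fun k => (k`!%:R : K)^-1 *: fps_pow f k i)) //.
  rewrite big_mkcond; apply: eq_bigr => k _.
  rewrite (@fps_powE _ _ _ n.+2) ?ltnS ?(leq_trans leim) //.
  case: ifPn => //; rewrite -ltnNge => ltik.
  by rewrite -(@fps_powE _ _ _ n.+2) ?ltnS ?(leq_trans leim) // fps_pow_gt // scaler0.
rewrite (expE _ n.+1) ?leqnn // big_ord_recl coef1 /= scaler0 add0r.
rewrite -sumrMnl.
transitivity (\sum_(k < n.+1) (k`!%:R : K)^-1 *: (p^`() * p ^+ k)`_n).
  apply: eq_bigr => k _; rewrite scalerMnr -coef_deriv /bump add1n.
  have -> : (p ^+ k.+1)^`() = (p^`() * p ^+ k) *+ k.+1.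
    by rewrite deriv_exp.
  rewrite coefMn -scaler_nat scalerA factS natrM invfM.
  by rewrite mulrAC mulVf ?natS_neq0 // mul1r.
rewrite (eq_bigr (fun k : 'I_n.+1 => \sum_(j < n.+1) (f j.+1 *+ j.+1) *
    ((k`!%:R : K)^-1 *: (p ^+ k)`_(n - j)))); last first.
  move=> k _; rewrite coefM scaler_sumr; apply: eq_bigr => j _.
  by rewrite coef_deriv coef_poly !ltnS -ltnS ltn_ord scalerAr.
rewrite exchange_big; apply: eq_bigr => j _ /=.
by rewrite -mulr_sumr (expE _ n) ?leq_subr ?leqnSn.
Qed.
End SymmetricFunctions.

(** * Elementary and complete symmetric functions, and Schur functions of columns *)

Section ElementarySymmetric.
Variables (K : fieldType) (A : comAlgType K).
Hypothesis charK0 : [pchar K] =i pred0.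
Implicit Types (p : nat -> A) (c : A).

Lemma newton_esymf p : newton (fun j => (-1) ^+ j * p j.+1) (esymf p).
Proof.
apply: eq_newton (newton_exp charK0 _) => // j.
rewrite scalerMnl -mulr_natr mulNr divfK ?natS_neq0 // exprS mulN1r opprK.
by rewrite -signr_odd -[in RHS]signr_odd scaler_sign mulr_sign.
Qed.

Lemma newton_hsymf p : newton (fun j => p j.+1) (hsymf p).
Proof.
apply: eq_newton (newton_exp charK0 _) => // j.
by rewrite scalerMnl -[_ *+ _]mulr_natr mulVf ?natS_neq0 // scale1r.
Qed.

Lemma esymf0 p : esymf p 0 = 1.
Proof. by have [] := newton_esymf p. Qed.

(** Only positive power sums enter. Relations such as [theta_shift] fail at [n = 0], where a
    denominator vanishes and its inverse defaults to 0. *)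
Lemma eq_esymf p p' :
  (forall n, p n.+1 = p' n.+1) -> esymf p =1 esymf p'.
Proof.
move=> pp'; apply: (newton_uniq charK0 _ (newton_esymf p')).
by apply: eq_newton (newton_esymf p) => j; rewrite pp'.
Qed.

Lemma esymfD p p' :
  esymf (fun n => p n + p' n) =1 fps_mul (esymf p) (esymf p').
Proof.
apply: (newton_uniq charK0 (newton_esymf _) _).
apply: eq_newton (newton_mul (newton_esymf p) (newton_esymf p')) => j.
by rewrite -mulrDr.
Qed.

Lemma esymf_scale c p r :
  esymf (fun n => c ^+ n * p n) r = c ^+ r * esymf p r.
Proof.
apply: (@newton_uniq _ _ charK0 _ _ (fun r => c ^+ r * esymf p r)
  (newton_esymf _)) r; split=> [|n].
  by rewrite esymf0 mulr1.
rewrite -mulrnAr (newton_esymf p).2 mulr_sumr; apply: eq_bigr => j _.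
have -> : c ^+ n.+1 = c ^+ j.+1 * c ^+ (n - j).
  by rewrite -exprD addSn subnKC // -ltnS.
ring.
Qed.

Lemma esymf_geom c r : esymf (fun n => c ^+ n) r = (1 + c *: 'X)`_r.
Proof.
apply: (@newton_uniq _ _ charK0 _ _ (fun r => (1 + c *: 'X)`_r)
  (newton_esymf _)) r; split=> [|n].
  by rewrite coefD coef1 coefZ coefX mulr0 addr0.
rewrite coefD coef1 coefZ coefX add0r.
case: n => [|n]; first by rewrite big_ord1 coefD coef1 coefZ coefX /=; ring.
rewrite mulr0 mul0rn 2!big_ord_recr big1 /= ?add0r => [|i _]; last first.
  rewrite coefD coef1 coefZ coefX.
  have -> : (n.+1 - i = (n - i.+1).+2)%N by have := ltn_ord i; lia.
  by rewrite mulr0 addr0 mulr0.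
rewrite subnn subSnn !coefD !coef1 !coefZ !coefX /= !exprS; ring.
Qed.

(** The power sums [c ^+ n] are those of one variable [c], so the generating series gains the factor
    [1 + c w]. *)
Lemma esymfD_geom p c r :
  esymf (fun n => p n + c ^+ n) r.+1 = esymf p r.+1 + c * esymf p r.
Proof.
rewrite esymfD fps_mulC /fps_mul 2!big_ord_recl big1 ?addr0 => [|i _].
  by rewrite !esymf_geom !coefD !coef1 !coefZ !coefX /bump /= subn0 subn1 /=; ring.
by rewrite esymf_geom coefD coef1 coefZ coefX mulr0 addr0 mul0r.
Qed.

(** The two factors have opposite logarithmic derivatives. *)
Lemma fps_mul_hsymf_esymf p :
  fps_mul (hsymf p) (fun n => (-1) ^+ n * esymf p n) =1 fps_one A.
Proof.
have newtonN : newton (fun j => - p j.+1) (fun n => (-1) ^+ n * esymf p n).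
  split=> [|n]; first by rewrite esymf0 mulr1.
  rewrite -mulrnAr (newton_esymf p).2 mulr_sumr; apply: eq_bigr => j _.
  have -> : (-1) ^+ n.+1 = - ((-1) ^+ j * (-1) ^+ (n - j)) :> A.
    by rewrite -exprD exprS subnKC ?mulN1r // -ltnS.
  by rewrite mulNr !mulrA -[X in - (X * _ * _)]mulrAC -expr2 sqrr_sign; ring.
apply: (newton_uniq charK0 _ (newton_one A)).
apply: eq_newton (newton_mul (newton_hsymf p) newtonN) => j.
by rewrite subrr.
Qed.

(** [H] is a unitriangular Toeplitz matrix with inverse [E], by [fps_mul_hsymf_esymf]. The
    Jacobi-Trudi matrix [J] is a submatrix of [H], so Cramer's rule gives its determinant as a
    corner entry of [E]. *)
Lemma schur_col p r : schur p (col_part r) = esymf p r.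
Proof.
have lenE : part_length (col_part r) = r.
  by rewrite /part_length /conj_part count_nseq mul1n.
rewrite /schur lenE.
set J := \matrix_(i < r, j < r) _.
pose H := \matrix_(i < r.+1, j < r.+1)
  (if (i <= j)%N then hsymf p (j - i) else 0).
pose E := \matrix_(i < r.+1, j < r.+1)
  (if (i <= j)%N then (-1) ^+ (j - i) * esymf p (j - i) else 0).
have HE : H *m E = 1%:M.
  apply/matrixP => i k; rewrite !mxE.
  rewrite (eq_bigr (fun j : 'I_r.+1 => if (i <= j <= k)%N then
      hsymf p (j - i) * ((-1) ^+ (k - j) * esymf p (k - j)) else 0)).
    case: (leqP i k) => [leik|ltki]; last first.
      rewrite big1 => [|j _]; last by case: ifP => //; lia.
      by case: eqP => // ik; rewrite ik ltnn in ltki.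
    rewrite -big_mkcond /=.
    have -> : (i == k) = (k - i == 0)%N.
      by rewrite -val_eqE eqn_leq leik subn_eq0.
    rewrite -[RHS](fps_mul_hsymf_esymf p) /fps_mul.
    pose G j := hsymf p (j - i) * ((-1) ^+ (k - j) * esymf p (k - j)).
    transitivity (\sum_(0 + i <= j < k.+1) G j); last first.
      rewrite big_addn subSn // big_mkord; apply: eq_bigr => j _.
      by rewrite /G addnK subnDA subnAC.
    rewrite add0n big_geq_mkord.
    rewrite (big_ord_widen_cond r.+1 (fun j => i <= j)%N G) //.
  move=> j _; rewrite !mxE.
  by case: (leqP i j) => ?; case: (leqP j k) => ?; rewrite ?mul0r ?mulr0.
have detH : \det H = 1.
  rewrite -det_tr det_trig.
    by rewrite big1 // => i _; rewrite !mxE leqnn subnn (newton_hsymf p).1.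
  by apply/is_trig_mxP => i j ltij; rewrite !mxE leqNgt ltij.
have adjH : \adj H = E.
  have := mul_adj_mx H; rewrite detH => adjK.
  by rewrite -[LHS]mulmx1 -HE mulmxA adjK mul1mx.
(* This entry of the adjugate is the cofactor deleting the last row and the first column; its sign
   cancels the one in [E]. *)
have := congr1 (fun M : 'M[A]_r.+1 => M ord0 ord_max) adjH.
rewrite !mxE /= subn0 /cofactor addn0 => /(congr1 ( *%R ((-1) ^+ r))).
rewrite !mulrA -expr2 sqrr_sign !mul1r => <-; congr (\det _).
apply/matrixP => i j; rewrite !mxE /= /bump.
have -> : (r <= i)%N = false by rewrite leqNgt ltn_ord.
have -> : part (col_part r) i.+1 = 1%N by rewrite /part nth_nseq ltn_ord.
by rewrite add0n add1n.
Qed.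

End ElementarySymmetric.

(** * Lagrange interpolation at the points [-1/x_j] *)

Section Interpolation.
Variable K : fieldType.

Lemma horner_prod_lin (I : finType) (P : pred I) (x : I -> K) (z : K) :
  (\prod_(m | P m) (1 + x m *: 'X)).[z] = \prod_(m | P m) (1 + x m * z).
Proof.
by rewrite horner_prod; apply: eq_bigr => m _; rewrite !hornerE.
Qed.

Lemma size_lin_le (a : K) : (size (1 + a *: 'X : {poly K})%R <= 2)%N.
Proof.
rewrite (leq_trans (size_polyD _ _)) // geq_max size_poly1 /=.
by rewrite (leq_trans (size_scale_leq _ _)) // size_polyX.
Qed.

Lemma size_prod_lin (I : finType) (P : pred I) (x : I -> K) :
  (size (\prod_(m | P m) (1 + x m *: 'X : {poly K}))%R <= #|P|.+1)%N.
Proof.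
rewrite (leq_trans (size_poly_prod_leq _ _)) // leq_subLR addnS ltnS.
rewrite (leq_trans (leq_sum _ (fun m _ => size_lin_le (x m)))) //.
by rewrite sum_nat_const; lia.
Qed.

Lemma coef_prod_lin n (x : 'I_n -> K) :
  (\prod_(m < n) (1 + x m *: 'X))`_n = \prod_(m < n) x m.
Proof.
elim: n x => [|n IHn] x; first by rewrite !big_ord0 coef1.
rewrite !big_ord_recl mulrDl mul1r coefD -scalerAl coefZ coefXM /= IHn.
rewrite nth_default ?add0r // (leq_trans (size_prod_lin _ _)) //.
by rewrite card_ord.
Qed.

Variables (n : nat) (x : 'I_n -> K) (y : K).
Hypotheses (x_inj : injective x) (x_neq0 : forall k, x k != 0).

(** The Lagrange basis up to scalars: at [-1/x_j] only [rest j] is nonzero. *)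
Let rest k : {poly K} := \prod_(m < n | m != k) (1 + x m *: 'X).

Lemma neg_invx_inj : injective (fun j => - (x j)^-1).
Proof. by move=> j k /oppr_inj/invr_inj/x_inj. Qed.

Lemma prod_lin_root j : \prod_(m < n) (1 + x m * - (x j)^-1) = 0.
Proof. by rewrite (bigD1 j) //= mulrN mulfV // subrr mul0r. Qed.

Lemma horner_rest k j : k != j -> (rest k).[- (x j)^-1] = 0.
Proof.
move=> kj; rewrite horner_prod_lin (bigD1 j) 1?eq_sym //=.
by rewrite mulrN mulfV // subrr mul0r.
Qed.

Lemma size_rest k : (size (rest k) <= n)%N.
Proof.
rewrite (leq_trans (size_prod_lin _ _)) //.
rewrite (leq_trans (_ : _ <= #|predC1 k|.+1)%N) ?subset_leq_card //.
by rewrite cardC1 card_ord prednK // (leq_ltn_trans _ (ltn_ord k)).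
Qed.

Lemma poly_eq_interp (p p' : {poly K}) :
  (size p <= n)%N -> (size p' <= n)%N ->
  (forall j, p.[- (x j)^-1] = p'.[- (x j)^-1]) -> p = p'.
Proof.
move=> sp sp' pp'; apply/subr0_eq.
apply: (roots_geq_poly_eq0 (rs := [seq - (x j)^-1 | j in 'I_n])).
- by apply/allP => _ /mapP[j _ ->]; rewrite rootE !hornerE pp' subrr.
- by rewrite map_inj_uniq ?enum_uniq //; exact: neg_invx_inj.
rewrite size_map size_enum_ord (leq_trans (size_polyD _ _)) //.
by rewrite size_polyN geq_max sp sp'.
Qed.

(** In the application [y = t2] and [l] is the last row kept, which is empty. The final denominator
    is what the product over the empty rows after [l] formally telescopes to. *)
Definition add_coef (l k : 'I_n) : K :=
  (\prod_(m < n | m != k) ((1 - y * x m / x k) / (1 - x m / x k)))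
  / (1 - y * x l / x k).

(** In the application [b] is the variable of the first row beyond those kept; its factor vanishes
    when row [k] is the last one kept and is empty. *)
Definition rem_coef (b : K) (k : 'I_n) : K :=
  (\prod_(m < n | m != k) ((1 - y * x k / x m) / (1 - x k / x m)))
  * (1 - y * x k / b).

Lemma sub1_div_neq0 j k : j != k -> 1 - x j / x k != 0.
Proof.
apply: contra; rewrite subr_eq0 => /eqP xjk; apply/eqP/x_inj.
by rewrite -[x j](divfK (x_neq0 k)) -xjk mul1r.
Qed.

(** Both sides have at most [n] coefficients, so they are compared at the [n] points [-1/x_j], where
    only the summand [k = j] survives. The hypothesis keeps the extra denominator of [add_coef]
    nonzero. *)
Lemma add_coef_interp l : (forall k, x k != y * x l) ->
  \sum_k ((1 - y) * add_coef l k) *: rest k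
  = \prod_(m < n | m != l) (1 + (y * x m) *: 'X).
Proof.
move=> xl; apply: poly_eq_interp => [||j].
- apply: (leq_trans (size_sum _ _ _)); apply/bigmax_leqP => k _.
  by rewrite (leq_trans (size_scale_leq _ _)) ?size_rest.
- rewrite (leq_trans (size_prod_lin _ _)) //.
  rewrite (leq_trans (_ : _ <= #|predC1 l|.+1)%N) ?subset_leq_card //.
  by rewrite cardC1 card_ord prednK // (leq_ltn_trans _ (ltn_ord l)).
have nz : 1 - y * x l / x j != 0.
  apply: contra (xl j); rewrite subr_eq0 => /eqP xjl; apply/eqP.
  by rewrite -[y * x l](divfK (x_neq0 j)) -xjl mul1r.
rewrite horner_sum (bigD1 j) //= big1 ?addr0 => [|k kj]; last first.
  by rewrite hornerZ horner_rest // mulr0.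
(* After multiplication by the extra denominator, both sides are the product of [1 - y x_m/x_j] over
   all [m]. *)
rewrite hornerZ !horner_prod_lin; apply: (mulIf nz).
transitivity (\prod_(m < n) (1 - y * x m / x j)).
  rewrite [RHS](bigD1 j) //= mulfK //.
  have <- : (\prod_(m < n | m != j) ((1 - y * x m / x j) / (1 - x m / x j)))
      * \prod_(m < n | m != j) (1 + x m * - (x j)^-1)
      = \prod_(m < n | m != j) (1 - y * x m / x j).
    rewrite -big_split; apply: eq_bigr => m mj /=.
    by rewrite mulrN divfK ?sub1_div_neq0.
  by rewrite /add_coef -[in RHS](divfK nz (\prod_(m < n | m != j) (_ / _))); ring.
rewrite (bigD1 l) //= mulrC; congr (_ * _).
by apply: eq_bigr => m _; rewrite mulrN.
Qed.

(** With [b = y ^+ n * a] the coefficients of degree [n + 1] on the right cancel, so both sides have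
    degree at most [n]. They agree at 0 and at the [n] points [-1/x_j], where the first product on
    the right vanishes. *)
Lemma rem_coef_interp a : y != 0 -> a != 0 ->
  \sum_k ((1 - y) / y * a * rem_coef (y ^+ n * a) k) *: ('X * rest k)
  = (\prod_(m < n) (1 + x m *: 'X)) * (1 + (a / y) *: 'X)
    - (1 + (y ^+ n * a / y) *: 'X) * \prod_(m < n) (1 + (x m / y) *: 'X).
Proof.
move=> y0 a0.
(* [o] and [o'] join the extra linear factor to the others, so that [coef_prod_lin] yields the top
   coefficients. *)
pose o := fun i : 'I_n.+1 => oapp x (a / y) (unlift ord0 i).
pose o' := fun i : 'I_n.+1 => oapp (fun m => x m / y) (y ^+ n * a / y)
  (unlift ord0 i).
have oE : (\prod_(m < n) (1 + x m *: 'X)) * (1 + (a / y) *: 'X) =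
    \prod_(i < n.+1) (1 + o i *: 'X).
  rewrite big_ord_recl /o unlift_none /= mulrC; congr (_ * _).
  by apply: eq_bigr => i _; rewrite liftK.
have o'E : (1 + (y ^+ n * a / y) *: 'X) * \prod_(m < n) (1 + (x m / y) *: 'X) =
    \prod_(i < n.+1) (1 + o' i *: 'X).
  rewrite big_ord_recl /o' unlift_none /=; congr (_ * _).
  by apply: eq_bigr => i _; rewrite liftK.
set p := \sum_k _; set p' := _ - _.
have sp' : (size p' <= n.+1)%N.
  apply/leq_sizeP => j; rewrite leq_eqVlt => /predU1P[<-|ltnj].
    rewrite coefB oE o'E !coef_prod_lin !big_ord_recl /o /o' !unlift_none /=.
    under eq_bigr do rewrite liftK.
    under [in X in _ - X]eq_bigr do rewrite liftK /=.
    rewrite big_split /= prodr_const card_ord exprVn.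
    by field; rewrite y0 expf_neq0.
  rewrite coefB oE o'E !nth_default ?subrr //;
    by rewrite (leq_trans (size_prod_lin _ _)) ?card_ord.
have sp : (size p <= n.+1)%N.
  apply: (leq_trans (size_sum _ _ _)); apply/bigmax_leqP => k _.
  rewrite (leq_trans (size_scale_leq _ _)) //.
  rewrite (leq_trans (size_polyMleq _ _)) // size_polyX add2n ltnS.
  exact: size_rest.
apply/subr0_eq.
apply: (roots_geq_poly_eq0 (rs := 0 :: [seq - (x j)^-1 | j in 'I_n])).
- rewrite /= rootE; apply/andP; split.
    rewrite hornerD hornerN /p horner_sum big1 => [|k _]; last first.
      by rewrite hornerZ hornerM hornerX mul0r mulr0.
    rewrite /p' hornerD hornerN oE o'E !horner_prod_lin.
    by rewrite !big1 ?subrr ?oppr0 ?addr0 // => i _; rewrite mulr0 addr0.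
  apply/allP => _ /mapP[j _ ->]; rewrite rootE hornerD hornerN subr_eq0.
  apply/eqP; rewrite /p horner_sum (bigD1 j) //= big1 ?addr0; last first.
    by move=> k kj; rewrite hornerZ hornerM horner_rest // !mulr0.
  rewrite /p' hornerD hornerN !hornerM !horner_prod_lin.
  rewrite prod_lin_root mul0r sub0r hornerZ hornerM hornerX horner_prod_lin.
  rewrite [in RHS](bigD1 j) //= /rem_coef !hornerE.
  (* Factor by factor, [1 - x_m/(y x_j)] is [(1 - x_m/x_j) (1 - y x_j/x_m) / (1 - x_j/x_m) / y], and
     there are [n - 1] factors. *)
  have -> : \prod_(m < n | m != j) (1 + x m / y * - (x j)^-1) =
      \prod_(m < n | m != j) (1 + x m * - (x j)^-1) *
      \prod_(m < n | m != j) ((1 - y * x j / x m) / (1 - x j / x m)) / y ^+ n.-1.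
    rewrite -[y ^+ _](_ : \prod_(m < n | m != j) y = _); last first.
      by rewrite prodr_const cardC1 card_ord.
    rewrite -prodfV -!big_split; apply: eq_bigr => m mj /=.
    have := sub1_div_neq0 mj; have := x_neq0 m; have := x_neq0 j => xj xm.
    have : x m - x j != 0 by rewrite subr_eq0 (inj_eq x_inj).
    have : x j - x m != 0 by rewrite subr_eq0 (inj_eq x_inj) eq_sym.
    move=> h1 h2 h3.
    field; rewrite ?y0 ?xj ?xm ?h1 ?h2 ?h3 //.
  have yn : y ^+ n = y * y ^+ n.-1.
    by rewrite -exprS prednK // (leq_ltn_trans _ (ltn_ord j)).
  rewrite yn; have yn0 := expf_neq0 n.-1 y0; have := x_neq0 j => xj.
  rewrite /=; field; rewrite ?yn0 ?y0 ?a0 ?xj //.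
- rewrite /= map_inj_uniq ?enum_uniq ?andbT; last exact: neg_invx_inj.
  by apply/mapP => -[j _ /esym/eqP]; rewrite oppr_eq0 invr_eq0 (negPf (x_neq0 j)).
rewrite /= size_map size_enum_ord (leq_trans (size_polyD _ _)) //.
by rewrite size_polyN geq_max sp sp'.
Qed.

End Interpolation.

(** * Parts and conjugate parts of sequences with trailing zeros *)

Lemma leq_part_conj s m j : sorted geq s -> (0 < j)%N ->
  (j <= nth 0%N s m)%N = (m < conj_part s j)%N.
Proof.
move=> s_sorted j_gt0; elim: s s_sorted m => [|a s IHs] /= s_sorted m.
  by rewrite nth_nil leqNgt j_gt0.
have lesa : all (geq a) s by rewrite (order_path_min _ s_sorted) //; exact: rev_trans leq_trans.
rewrite /conj_part /=; case: (leqP j a) => ja; last first.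
  have -> : count (leq j) s = 0%N.
    apply/eqP; rewrite -leqn0 leqNgt -has_count; apply/hasPn => b bs.
    by rewrite -ltnNge (leq_ltn_trans _ ja) //; exact: (allP lesa).
  case: m => [|m] /=; first by rewrite leqNgt ja.
  case: (ltnP m (size s)) => sm; last by rewrite nth_default // leqNgt j_gt0.
  apply/negbTE; rewrite -ltnNge (leq_ltn_trans _ ja) //.
  by apply: (allP lesa); rewrite mem_nth.
by case: m => [|m] //=; rewrite add1n ltnS IHs // (path_sorted s_sorted).
Qed.

Lemma part_length_gt s m :
  sorted geq s -> (part_length s <= m)%N -> nth 0%N s m = 0%N.
Proof. by move=> ss; rewrite leqNgt -leq_part_conj // -eqn0Ngt => /eqP. Qed.

Lemma part_length_size s : (part_length s <= size s)%N.
Proof. exact: count_size. Qed.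

(** * The specialization at [q^eta t^rho] in terms of row variables *)

Section Specialization.
Variables (K : fieldType) (q u : K).
Hypothesis charK0 : [pchar K] =i pred0.
Hypotheses (q_neq0 : q != 0) (u_neq0 : u != 0).
Hypothesis qu_generic : forall a b : int, q ^ a * u ^ b = 1 -> a = 0 /\ b = 0.

Let t2 : K := u ^- 2.

(** Rows are counted from 0, so [u ^- (2 * m + 1)] is [t^(1/2 - (m + 1))]. The variables of the
    empty rows form a geometric progression of ratio [t2]. *)
Definition row_var (s : seq nat) (m : nat) : K := q ^+ nth 0%N s m / u ^+ (2 * m + 1).

(** The power sums at [t^rho]: the closed form of the geometric series of [u ^- (n * (2 * m + 1))]
    over [m >= 0]. *)
Definition theta (n : nat) : K^o := (u ^+ n - u ^- n)^-1.

Definition esp (s : seq nat) : nat -> K := esymf (psum_spec q u (1 : K^o) 0 s).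

Lemma t2_neq0 : t2 != 0.
Proof. by rewrite invr_neq0 ?expf_neq0. Qed.

Lemma t2_exp m : t2 ^+ m / u = u ^- (2 * m + 1).
Proof. by rewrite /t2 -!exprVn -exprM -[u^-1 in X in _ * X]expr1 -exprD. Qed.

Lemma monomial_inj a b a' b' :
  q ^+ a / u ^+ b = q ^+ a' / u ^+ b' -> a = a' /\ b = b'.
Proof.
move=> ab; have [] := @qu_generic (a%:Z - a'%:Z) (b'%:Z - b%:Z); last by lia.
rewrite !expfzDr // -!exprnN -!exprnP mulrACA.
have := congr1 (fun z => z * q ^- a' * u ^+ b') ab.
rewrite [in X in _ = X -> _]mulrAC divfK ?expf_neq0 // mulfV ?expf_neq0 // => <-.
ring.
Qed.

Lemma row_var_inj s : injective (row_var s).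
Proof. by move=> k j /monomial_inj[_]; lia. Qed.

Lemma row_var_neq0 s k : row_var s k != 0.
Proof. by rewrite mulf_neq0 ?invr_neq0 ?expf_neq0. Qed.

Lemma expu_neq1 n : (0 < n)%N -> u ^+ n != 1.
Proof.
move=> n0; apply/eqP => un; have [] := @qu_generic 0 n; last by lia.
by rewrite expr0z mul1r -exprnP.
Qed.

Lemma theta_shift n : (0 < n)%N -> theta n = u ^- n + t2 ^+ n * theta n.
Proof.
move=> n0; have un0 : u ^+ n != 0 by rewrite expf_neq0.
have nz : u ^+ n * u ^+ n - 1 != 0.
  by rewrite subr_eq0 -exprD expu_neq1 // addn_gt0 n0.
rewrite /theta /t2 exprVn exprAC.
have -> : u ^+ n - u ^- n = (u ^+ n * u ^+ n - 1) / u ^+ n.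
  by rewrite mulrBl mulfK // mul1r.
by field; rewrite un0 nz.
Qed.

(** Zero rows contribute nothing, so the sum may run over the whole sequence. *)
Lemma psum_spec_rows (A : comAlgType K) (c L : A) (s : seq nat) (n : nat) :
  sorted geq s -> psum_spec q u c L s n =
    (\sum_(m < size s) (row_var s m ^+ n - u ^- (n * (2 * m + 1)))) *: c ^+ n
    + theta n *: (c ^+ n - L ^+ n).
Proof.
move=> s_sorted; rewrite /psum_spec; congr (_ *: _ + _).
rewrite big_add1 /= big_mkord.
rewrite (big_ord_widen (size s) (fun m : nat =>
  (q ^+ (n * part s m.+1) - 1) * u ^ (n%:Z * (1 - 2 * (m.+1)%:Z)))); last first.
  exact: part_length_size.
rewrite big_mkcond; apply: eq_bigr => m _.
have -> : u ^ (n%:Z * (1 - 2 * m.+1%:Z)) = u ^- (n * (2 * m + 1)).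
  by rewrite exprnN; congr (_ ^ _); lia.
rewrite /part /= /row_var; case: ifPn => [_|]; last first.
  rewrite -leqNgt => /(part_length_gt s_sorted) ->.
  by rewrite expr0 mul1r exprVn -exprM mulnC subrr.
by rewrite exprMn exprVn -!exprM [(n * (_ + _))%N]mulnC [(n * _)%N]mulnC mulrBl mul1r.
Qed.

Lemma theta_tail N n : (0 < n)%N ->
  theta n = \sum_(m < N) u ^- (n * (2 * m + 1)) + (t2 ^+ N) ^+ n * theta n.
Proof.
move=> n0; elim: N => [|N IHN]; first by rewrite big_ord0 expr0 expr1n mul1r add0r.
rewrite big_ord_recr /= {1}IHN -addrA; congr (_ + _).
rewrite {1}theta_shift // mulrDr mulrA; congr (_ + _).
  by rewrite /t2 -!exprVn -!exprM -exprD; congr (_ ^+ _); lia.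
by rewrite exprSr exprMn.
Qed.

(** [e_r] of the variables of the rows from index [N] on, all of them empty. *)
Definition tail (N r : nat) : K := (t2 ^+ N) ^+ r * esymf theta r.

(** Splitting off the first variable [b = t2^N/u] of the progression: the generating series
    satisfies [T(w) = (1 + b w) T(t2 w)]. *)
Lemma tailS N r :
  tail N r.+1 = t2 ^+ r.+1 * tail N r.+1 + t2 ^+ N / u * (t2 ^+ r * tail N r).
Proof.
have thE : esymf theta r.+1 =
    t2 ^+ r.+1 * esymf theta r.+1 + u^-1 * (t2 ^+ r * esymf theta r).
  rewrite {1}(eq_esymf charK0 (p' := fun n => (t2 : K^o) ^+ n * theta n + (u^-1 : K^o) ^+ n)).
    by rewrite esymfD_geom // !esymf_scale.
  by move=> n; rewrite [LHS]theta_shift // -exprVn addrC.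
by rewrite /tail {1}thE [(t2 ^+ N) ^+ r.+1]exprS; ring.
Qed.

Lemma esymf_prod (A : comAlgType K) N (x : 'I_N -> A) (p : nat -> A) :
  esymf (fun n => \sum_(m < N) x m ^+ n + p n) =1
  fps_mul (fun i => (\prod_(m < N) (1 + x m *: 'X))`_i) (esymf p).
Proof.
elim: N x => [|N IHN] x r.
  rewrite (@eq_esymf _ _ charK0 _ p); last by move=> n; rewrite big_ord0 add0r.
  rewrite fps_mulC -[LHS](fps_mulr1 (esymf p)).
  by apply: eq_fps_mul => // i; rewrite big_ord0 coef1.
rewrite (@eq_esymf _ _ charK0 _ (fun n => x ord0 ^+ n +
    (\sum_(m < N) x (lift ord0 m) ^+ n + p n))); last first.
  by move=> n; rewrite big_ord_recl addrA.
rewrite esymfD // (eq_fps_mul (esymf_geom charK0 _) (IHN _)) fps_mulA.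
by apply: eq_fps_mul => // i; rewrite big_ord_recl coefM.
Qed.

(** [e_r] of all row variables except [x_k], the infinitely many empty rows being included through
    [tail]. *)
Definition rest (s : seq nat) (k r : nat) : K :=
  fps_mul (fun i => (\prod_(m < size s | m != k :> nat) (1 + row_var s m *: 'X))`_i)
    (tail (size s)) r.

Lemma espE s : sorted geq s -> esp s =1
  fps_mul (fun i => (\prod_(m < size s) (1 + row_var s m *: 'X))`_i) (tail (size s)).
Proof.
move=> s_sorted r.
rewrite /esp (@eq_esymf _ _ charK0 _ (fun n => \sum_(m < size s) (row_var s m : K^o) ^+ n +
    (t2 ^+ size s : K^o) ^+ n * theta n)).
  by rewrite esymf_prod; apply: eq_fps_mul => // i; rewrite esymf_scale.
move=> n; rewrite psum_spec_rows // expr1n expr0n subr0.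
rewrite [_ *: _]mulr1 [_ *: _]mulr1 {1}(theta_tail (size s)) //.
by rewrite sumrB addrA subrK.
Qed.

Lemma esp_rest s k r : sorted geq s -> (k < size s)%N ->
  esp s r = rest s k r + row_var s k * (if r is r'.+1 then rest s k r' else 0).
Proof.
move=> s_sorted ks; rewrite espE // (eq_fps_mul (f' := fun i =>
  ((1 + row_var s k *: 'X) *
   \prod_(m < size s | m != k :> nat) (1 + row_var s m *: 'X))`_i) _ (frefl _)).
  rewrite /rest /fps_mul; under eq_bigr do rewrite mulrDl mul1r coefD mulrDl.
  rewrite big_split /=; congr (_ + _).
  rewrite big_ord_recl -scalerAl coefZ coefXM mulr0 mul0r add0r.
  case: r => [|r]; first by rewrite big_ord0 mulr0.
  rewrite mulr_sumr; apply: eq_bigr => i _.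
  by rewrite coefZ coefXM /= -mulrA /bump !add0n add1n subSS.
by move=> i; rewrite (bigD1 (Ordinal ks)) //=; congr ((_ * _)`_i); apply: eq_bigl.
Qed.

(** Multiplication by the series of [tail] carries interpolation over finitely many rows to all
    rows. *)
Lemma rest_sum (s : seq nat) (c : 'I_(size s) -> K) (p : {poly K}) r :
  \sum_k c k *: (\prod_(m < size s | m != k) (1 + row_var s m *: 'X)) = p ->
  \sum_k c k * rest s k r = fps_mul (fun i => p`_i) (tail (size s)) r.
Proof.
move=> <-; rewrite /rest /fps_mul.
under eq_bigr do rewrite mulr_sumr.
rewrite exchange_big; apply: eq_bigr => i _ /=.
by rewrite coef_sum mulr_suml; apply: eq_bigr => k _; rewrite coefZ mulrA.
Qed.

Lemma fps_mul_scale (a : K) (f g : nat -> K) r :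
  fps_mul (fun i => a ^+ i * f i) (fun i => a ^+ i * g i) r = a ^+ r * fps_mul f g r.
Proof.
rewrite mulr_sumr; apply: eq_bigr => i _.
have -> : a ^+ r = a ^+ i * a ^+ (r - i) by rewrite -exprD subnKC // -ltnS.
ring.
Qed.

Lemma fps_mul_lin (a : K) (f : nat -> K) r :
  fps_mul (fun i => (1 + a *: 'X)`_i) f r =
  f r + a * (if r is r'.+1 then f r' else 0).
Proof.
rewrite /fps_mul big_ord_recl coefD coef1 coefZ coefX mulr0 addr0 mul1r subn0.
congr (_ + _); case: r => [|r]; first by rewrite big_ord0 mulr0.
rewrite big_ord_recl big1 ?addr0 => [|i _].
  by rewrite coefD coef1 coefZ coefX mulr1 add0r subSS subn0.
by rewrite coefD coef1 coefZ coefX mulr0 addr0 mul0r.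
Qed.

Lemma coef_prod_scale N (x : 'I_N -> K) a i :
  (\prod_(m < N) (1 + (a * x m) *: 'X))`_i =
  a ^+ i * (\prod_(m < N) (1 + x m *: 'X))`_i.
Proof.
elim: N x i => [|N IHN] x i.
  by rewrite !big_ord0 coef1; case: i => [|i]; rewrite ?mulr1 ?mulr0.
rewrite !big_ord_recl !mulrDl !mul1r !coefD -!scalerAl !coefZ !coefXM IHN.
by case: i => [|i] /=; rewrite ?mulr0 ?addr0 // IHN exprS; ring.
Qed.

Lemma fps_mul_coef (p p' : {poly K}) f r :
  fps_mul (fun i => p`_i) (fps_mul (fun i => p'`_i) f) r =
  fps_mul (fun i => (p * p')`_i) f r.
Proof. by rewrite fps_mulA; apply: eq_fps_mul => // i; rewrite coefM. Qed.

(** Interpolation gives the product of [1 + t2 x_m w] over [m != l], times the tail series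
    [T(w) = (1 + b w) T(t2 w)]. As row [l] is last and empty, [b = t2 x_l] supplies the missing
    factor, and the result is the series of [esp s] at [t2 w]. *)
Lemma add_sum (s : seq nat) (l : 'I_(size s)) r :
  sorted geq s -> size s = l.+1 -> nth 0%N s l = 0%N ->
  \sum_k (1 - t2) * add_coef (fun m : 'I_(size s) => row_var s m) t2 l k * rest s k r
  = t2 ^+ r * esp s r.
Proof.
move=> s_sorted sl nsl.
have xinj : injective (fun m : 'I_(size s) => row_var s m).
  by move=> k j /row_var_inj/val_inj.
have rowl : t2 * row_var s l = t2 ^+ size s / u.
  by rewrite /row_var nsl expr0 mul1r -t2_exp mulrA -exprS -sl.
have xl k : row_var s k != t2 * row_var s l \/ (l < k)%N.
  case: (ltnP l k) => [|lekl]; [by right|left].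
  rewrite /row_var nsl mulrCA /t2 -invfM -exprD; apply/eqP => /monomial_inj[_]; lia.
rewrite (@rest_sum s _ (\prod_(m < size s | m != l) (1 + (t2 * row_var s m) *: 'X))).
  rewrite espE // -fps_mul_scale.
  transitivity (fps_mul (fun i =>
     (\prod_(m < size s | m != l) (1 + (t2 * row_var s m) *: 'X))`_i)
     (fps_mul (fun i => (1 + (t2 ^+ size s / u) *: 'X)`_i)
       (fun i => t2 ^+ i * tail (size s) i)) r).
    apply: eq_fps_mul => // i; rewrite fps_mul_lin.
    case: i => [|i]; first by rewrite mulr0 addr0 mul1r.
    exact: tailS.
  rewrite [LHS](fps_mul_coef (\prod_(m < size s | m != l) _) (1 + _ *: 'X)).
  apply: eq_fps_mul => [i|i]; last by [].
  rewrite -coef_prod_scale [in RHS](bigD1 l) //= rowl mulrC.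
  by [].
apply: add_coef_interp => // k; first exact: row_var_neq0.
by have [//|] := xl k; have := ltn_ord k; lia.
Qed.

(** Interpolation is used with [a = u^-1], so that [b] is the first row variable beyond the
    sequence. Its two products lead to the series of [esp s] at [w] and at [w/t2]; in the second,
    [1 + (b/t2) w] turns [T(w)] into [T(w/t2)]. *)
Lemma rem_sum (s : seq nat) r :
  sorted geq s ->
  \sum_k (1 - t2) * rem_coef (fun m : 'I_(size s) => row_var s m) t2
     (t2 ^+ size s / u) k * rest s k r
  = u * (t2 - t2 ^- r) * esp s r.+1 + esp s r.
Proof.
move=> s_sorted.
have xinj : injective (fun m : 'I_(size s) => row_var s m).
  by move=> k j /row_var_inj/val_inj.
have y0 := t2_neq0.
have /= := rem_coef_interp xinj (fun k => row_var_neq0 s k) y0 (invr_neq0 u_neq0).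
set E := \prod_(m < size s) (1 + row_var s m *: 'X).
set E' := \prod_(m < size s) (1 + (row_var s m / t2) *: 'X) => interp.
have E'E i : E'`_i = t2 ^- i * E`_i.
  have E'V : E' = \prod_(m < size s) (1 + (t2^-1 * row_var s m) *: 'X).
    by apply: eq_bigr => m _; rewrite mulrC.
  by rewrite -exprVn -coef_prod_scale E'V.
have tail'E : (fun i => t2 ^- i * tail (size s) i) =1
    fps_mul (fun i => (1 + (t2 ^+ size s / u / t2) *: 'X)`_i) (tail (size s)).
  move=> i; rewrite fps_mul_lin; case: i => [|i].
    by rewrite expr0 invr1 mul1r mulr0 addr0.
  rewrite {1}tailS mulrDr mulKf ?expf_neq0 // exprS invfM; congr (_ + _).
  by field; rewrite y0 u_neq0 expf_neq0.
(* Index [r.+1] is taken because [rem_coef_interp] carries a factor ['X] in front of [rest]. *)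
have coefE : fps_mul (fun i => (E * (1 + (u^-1 / t2) *: 'X)
    - (1 + (t2 ^+ size s / u / t2) *: 'X) * E')`_i) (tail (size s)) r.+1
    = esp s r.+1 + u^-1 / t2 * esp s r - t2 ^- r.+1 * esp s r.+1.
  rewrite /fps_mul; under eq_bigr do rewrite coefB mulrBl.
  rewrite sumrB -/(fps_mul (fun i => (E * _)`_i) _ r.+1).
  rewrite -/(fps_mul (fun i => (_ * E')`_i) _ r.+1); congr (_ - _).
    rewrite mulrC -fps_mul_coef fps_mul_lin; congr (_ + _ * _); by rewrite espE.
  rewrite mulrC -fps_mul_coef -exprVn espE // -fps_mul_scale.
  by apply: eq_fps_mul => i; [rewrite E'E (exprVn t2) | rewrite -tail'E (exprVn t2)].
have interp' : \sum_k ((1 - t2) / t2 / u * rem_coef (fun m : 'I_(size s) => row_var s m) t2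
     (t2 ^+ size s / u) k) * rest s k r = 
     esp s r.+1 + u^-1 / t2 * esp s r - t2 ^- r.+1 * esp s r.+1.
  rewrite -coefE -interp (rest_sum _ (erefl _)).
  rewrite /fps_mul [RHS]big_ord_recl [X in _ = X * _ + _]coef_sum.
  rewrite [X in _ = X * _ + _]big1 ?mul0r ?add0r => [|k _]; last first.
    by rewrite coefZ coefXM mulr0.
  apply: eq_bigr => i _; congr (_ * _).
  by rewrite !coef_sum; apply: eq_bigr => k _; rewrite !coefZ coefXM.
have -> : u * (t2 - t2 ^- r) * esp s r.+1 + esp s r = t2 * u *
   (esp s r.+1 + u^-1 / t2 * esp s r - t2 ^- r.+1 * esp s r.+1).
  by rewrite exprS; field; rewrite y0 u_neq0 expf_neq0.
rewrite -interp' mulr_sumr; apply: eq_bigr => k _.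
by field; rewrite y0 u_neq0.
Qed.

End Specialization.

(** * Box weights as products over pairs of rows, and the effect of adding a box *)

Section BoxWeight.
Variables (K : fieldType) (q u : K).
Hypotheses (q_neq0 : q != 0) (u_neq0 : u != 0).
Hypothesis qu_generic : forall a b : int, q ^ a * u ^ b = 1 -> a = 0 /\ b = 0.

Let t := u ^+ 2.
Let t2 : K := u ^- 2.

(** The denominator for one box, with [d] the arm length plus one and [e] the leg length. *)
Definition box_factor (d e : nat) : K :=
  (1 - q ^+ d * t ^+ e) * (1 - q / (q ^+ d * t ^+ e.+1)).

Definition strip_factor (e d : nat) : K := \prod_(p < d) box_factor p.+1 e.

(** In row [i] the boxes of one leg length lie between two consecutive parts and give a quotient of
    two strips. Here these strips are regrouped by the part [s_m] on which they depend. *)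
Definition pair_factor (s : seq nat) (i m : nat) : K :=
  strip_factor (m - i.+1) (nth 0%N s i - nth 0%N s m) /
  strip_factor (m - i) (nth 0%N s i - nth 0%N s m).

Lemma t_neq0 : t != 0.
Proof. by rewrite expf_neq0. Qed.

(** The exponent of [q] in the first factor and that of [t] in the second are nonzero. *)
Lemma box_factor_neq0 d e : (0 < d)%N -> box_factor d e != 0.
Proof.
move=> d0; rewrite mulf_neq0 // subr_eq0; apply/eqP => /esym qt.
  have [] := @qu_generic d (2 * e)%N; last by lia.
  by rewrite -!exprnP exprM.
have [] := @qu_generic (1 - d%:Z) (- (2 * e.+1)%:Z); last by lia.
rewrite expfzDr // expr1z -!exprnN exprM.
by rewrite invfM mulrA in qt.
Qed.

Lemma strip_factor_neq0 e d : strip_factor e d != 0.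
Proof. by apply/prodf_neq0 => p _; rewrite box_factor_neq0. Qed.

Lemma strip_factorS e d :
  strip_factor e d.+1 = strip_factor e d * box_factor d.+1 e.
Proof. by rewrite /strip_factor big_ord_recr. Qed.

Lemma prod_strip e (a b c : nat) : (a <= b <= c)%N ->
  \prod_(a <= j < b) box_factor (c - j) e =
  strip_factor e (c - a) / strip_factor e (c - b).
Proof.
move=> /andP[]; elim: b => [|b IHb].
  by rewrite leqn0 => /eqP -> _; rewrite big_geq // divff // strip_factor_neq0.
rewrite leq_eqVlt => /predU1P[<- _|].
  by rewrite big_geq // divff // strip_factor_neq0.
rewrite ltnS => leab ltbc; rewrite big_nat_recr //= IHb // 1?ltnW //.
have -> : (c - b = (c - b.+1).+1)%N by lia.
rewrite strip_factorS; have := strip_factor_neq0 e (c - b.+1).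
have := @box_factor_neq0 (c - b.+1).+1 e isT => nz1 nz2.
by field; rewrite ?nz1 ?nz2.
Qed.

Lemma conj_partE s m j : sorted geq s ->
  (nth 0%N s m.+1 <= j < nth 0%N s m)%N -> conj_part s j.+1 = m.+1.
Proof.
move=> s_sorted /andP[]; rewrite leqNgt leq_part_conj // leq_part_conj //.
by rewrite -leqNgt => le1 le2; apply/eqP; rewrite eqn_leq le1 le2.
Qed.

Lemma sorted_nth_le s i m : sorted geq s -> (i <= m)%N ->
  (nth 0%N s m <= nth 0%N s i)%N.
Proof.
move=> s_sorted leim; case: (posnP (nth 0%N s m)) => [-> //|m_gt0].
by rewrite leq_part_conj // (leq_ltn_trans leim) // -leq_part_conj.
Qed.

(** By induction on [p]: the columns between [s_(m+1)] and [s_m] have height [m + 1], so their boxes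
    in row [i] have leg [m - i] and form a quotient of strips. *)
Lemma row_weight s i p : sorted geq s ->
  \prod_(nth 0%N s (i + p.+1) <= j < nth 0%N s i)
     box_factor (nth 0%N s i - j) (conj_part s j.+1 - i.+1) =
  (\prod_(i.+1 <= m < i + p.+1) pair_factor s i m) *
  strip_factor p (nth 0%N s i - nth 0%N s (i + p.+1)).
Proof.
move=> s_sorted.
have stripE m : (i <= m)%N ->
    \prod_(nth 0%N s m.+1 <= j < nth 0%N s m)
      box_factor (nth 0%N s i - j) (conj_part s j.+1 - i.+1) =
    strip_factor (m - i) (nth 0%N s i - nth 0%N s m.+1) /
    strip_factor (m - i) (nth 0%N s i - nth 0%N s m).
  move=> leim; rewrite -prod_strip ?sorted_nth_le //.
  by apply: eq_big_nat => j /conj_partE ->.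
elim: p => [|p IHp].
  rewrite addn1 stripE // subnn [X in _ / strip_factor _ X]subnn.
  by rewrite {2}/strip_factor big_ord0 divr1 big_geq ?mul1r.
rewrite (@big_cat_nat _ _ _ (nth 0%N s (i + p.+1))) ?sorted_nth_le //=; try lia.
rewrite IHp [(i + p.+2)%N]addnS stripE; last lia.
rewrite big_nat_recr /=; last lia.
rewrite /pair_factor addKn; have -> : (i + p.+1 - i.+1 = p)%N by lia.
have := strip_factor_neq0 p.+1 (nth 0%N s i - nth 0%N s (i + p.+1)).
by move=> nz; field.
Qed.

Lemma box_weightE s : sorted geq s -> box_weight q u s =
  (\prod_(i < size s) (strip_factor (size s - i.+1) (nth 0%N s i) *
    \prod_(m < size s | (i < m)%N) pair_factor s i m))^-1.
Proof.
move=> s_sorted; rewrite /box_weight.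
rewrite (@big_nat_widen _ _ _ 1 _ (size s).+1) ?ltnS ?part_length_size //.
rewrite big_add1 /= big_mkord -prodfV.
rewrite big_mkcond; apply: eq_bigr => i _; rewrite ltnS big_add1 /= /part /=.
transitivity ((\prod_(0 <= j < nth 0%N s i)
     box_factor (nth 0%N s i - j) (conj_part s j.+1 - i.+1))^-1).
  case: ifPn => [_|]; last first.
    rewrite -leqNgt => /(part_length_gt s_sorted) ->.
    by rewrite big_geq // invr1.
  rewrite -prodfV; apply: eq_big_nat => j /= ltj; congr (_^-1).
  have := ltj; rewrite leq_part_conj // => ltic.
  rewrite /box_factor -/t; congr ((1 - _) * (1 - _)).
    by rewrite !exprnP; congr (_ ^ _ * _ ^ _); lia.
  have -> : - (nth 0%N s i)%:Z + j.+1%:Z = 1 - (nth 0%N s i - j)%N%:Z by lia.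
  rewrite expfzDr // expr1z -exprnN invfM mulrA; congr (_ * _).
  by rewrite exprnN; congr (_ ^ _); lia.
congr (_^-1); have ltis := ltn_ord i.
(* The range of columns starts at the part of index [size s], which is the default 0, so all boxes
   of row [i] are counted. *)
have := row_weight i (size s - i.+1) s_sorted.
have -> : (i + (size s - i.+1).+1 = size s)%N by lia.
rewrite (nth_default _ (leqnn _)) subn0 => ->; rewrite mulrC; congr (_ * _).
by rewrite big_geq_mkord.
Qed.

Definition partition_weight_inv (N : nat) (s : seq nat) : K :=
  \prod_(i < N) (strip_factor (N - i.+1) (nth 0%N s i) *
    \prod_(m < N | (i < m)%N) pair_factor s i m).

Section AddBox.
Variables (N : nat) (s : seq nat) (k : 'I_N).
Let s' := incr_nth s k.
Hypotheses (s_size : size s = N) (s_sorted : sorted geq s).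
Hypothesis s'_sorted : sorted geq s'.

(** For the variable [z] of another row, [numer z / denom z] is the change of the inverse weight due
    to that row and row [k]. It is also a factor of [rem_coef] for [s'] divided by one of [add_coef]
    for [s]. *)
Let numer (z : K) : K :=
  (1 - z / row_var q u s k) * (1 - t2 * (q * row_var q u s k) / z).
Let denom (z : K) : K :=
  (1 - t2 * z / row_var q u s k) * (1 - q * row_var q u s k / z).
Let ratio m := numer (row_var q u s m) / denom (row_var q u s m).

Lemma size_add_box : size s' = N.
Proof. by rewrite size_incr_nth s_size ltn_ord. Qed.

Lemma nth_add_box m : nth 0%N s' m = ((k == m :> nat) + nth 0%N s m)%N.
Proof. exact: nth_incr_nth. Qed.

Lemma row_var_add_box m : row_var q u s' m =
  if m == k then q * row_var q u s k else row_var q u s m.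
Proof.
rewrite /row_var nth_add_box eq_sym; case: eqP => [->|_] //.
by rewrite add1n exprS mulrA.
Qed.

(** The new box raises the leg of the box above it in row [i] from [k - i - 1] to [k - i]. *)
Lemma box_factor_above i : (i < k)%N ->
  box_factor (nth 0%N s i - nth 0%N s k) (k - i) = numer (row_var q u s i) /\
  box_factor (nth 0%N s i - nth 0%N s k) (k - i.+1) = denom (row_var q u s i).
Proof.
move=> ltik; have leki := sorted_nth_le s_sorted (ltnW ltik).
rewrite /numer /denom /box_factor /row_var /t2 -/t.
have -> : q ^+ nth 0%N s i = q ^+ (nth 0%N s i - nth 0%N s k) * q ^+ nth 0%N s k.
  by rewrite -exprD subnK.
have -> : u ^+ (2 * k + 1) = t * t ^+ (k - i.+1) * u ^+ (2 * i + 1).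
  by rewrite /t -exprS -exprM -exprD; congr (_ ^+ _); lia.
have -> : (k - i = (k - i.+1).+1)%N by lia.
have := expf_neq0 (nth 0%N s i - nth 0%N s k) q_neq0.
have := expf_neq0 (nth 0%N s k) q_neq0.
have := expf_neq0 (2 * i + 1)%N u_neq0; have := expf_neq0 (k - i.+1)%N t_neq0.
rewrite !exprS -/t; have := t_neq0 => n1 n2 n3 n4 n5.
by split; congr (_ * _); field; rewrite ?n1 ?n2 ?n3 ?n4 ?n5.
Qed.

(** These are the factors by which the two strips of [pair_factor s k m] grow when row [k] gets
    longer. *)
Lemma box_factor_below m : (k < m)%N ->
  box_factor (nth 0%N s k - nth 0%N s m).+1 (m - k.+1) = numer (row_var q u s m) /\
  box_factor (nth 0%N s k - nth 0%N s m).+1 (m - k) = denom (row_var q u s m).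
Proof.
move=> ltkm; have lemk := sorted_nth_le s_sorted (ltnW ltkm).
rewrite /numer /denom /box_factor /row_var /t2 -/t ![_ * (1 - q / _)]mulrC.
have -> : q ^+ nth 0%N s k = q ^+ (nth 0%N s k - nth 0%N s m) * q ^+ nth 0%N s m.
  by rewrite -exprD subnK.
have -> : u ^+ (2 * m + 1) = t * t ^+ (m - k.+1) * u ^+ (2 * k + 1).
  by rewrite /t -exprS -exprM -exprD; congr (_ ^+ _); lia.
have -> : (m - k = (m - k.+1).+1)%N by lia.
have := expf_neq0 (nth 0%N s k - nth 0%N s m) q_neq0.
have := expf_neq0 (nth 0%N s m) q_neq0.
have := expf_neq0 (2 * k + 1)%N u_neq0; have := expf_neq0 (m - k.+1)%N t_neq0.
rewrite !exprS -/t; have := t_neq0; have := q_neq0 => n0 n1 n2 n3 n4 n5.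
by split; congr (_ * _); field; rewrite ?n0 ?n1 ?n2 ?n3 ?n4 ?n5.
Qed.

Lemma above_gt i : (i < k)%N -> (nth 0%N s k < nth 0%N s i)%N.
Proof.
move=> ltik; have := sorted_nth_le s'_sorted (ltnW ltik).
by rewrite !nth_add_box eqxx gtn_eqF.
Qed.

Lemma numer_neq0 (m : 'I_N) : m != k -> numer (row_var q u s m) != 0.
Proof.
rewrite -val_eqE neq_ltn => /orP[ltmk|ltkm].
  rewrite -(box_factor_above ltmk).1 box_factor_neq0 // subn_gt0.
  exact: above_gt.
by rewrite -(box_factor_below ltkm).1 box_factor_neq0.
Qed.

Lemma denom_neq0 (m : 'I_N) : m != k -> denom (row_var q u s m) != 0.
Proof.
rewrite -val_eqE neq_ltn => /orP[ltmk|ltkm].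
  rewrite -(box_factor_above ltmk).2 box_factor_neq0 // subn_gt0.
  exact: above_gt.
by rewrite -(box_factor_below ltkm).2 box_factor_neq0.
Qed.

Lemma pair_factor_below (m : 'I_N) : (k < m)%N ->
  pair_factor s' k m = pair_factor s k m * ratio m.
Proof.
move=> ltkm; have lemk := sorted_nth_le s_sorted (ltnW ltkm).
have km : m != k by rewrite -val_eqE gtn_eqF.
rewrite /pair_factor !nth_add_box eqxx ltn_eqF // add0n add1n subSn //.
have := denom_neq0 km; rewrite /ratio.
have [<- <-] := box_factor_below ltkm.
set d := (nth _ s k - nth _ s m)%N.
rewrite !strip_factorS => nz; have := strip_factor_neq0 (m - k) d => nz'.
by field; rewrite nz nz'.
Qed.

(** Both strips get shorter by one box, so the two box factors enter inverted. *)
Lemma pair_factor_above (i : 'I_N) : (i < k)%N ->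
  pair_factor s' i k = pair_factor s i k * ratio i.
Proof.
move=> ltik; have ltki := above_gt ltik.
have ki : i != k by rewrite -val_eqE ltn_eqF.
rewrite /pair_factor !nth_add_box eqxx gtn_eqF // add0n add1n.
have := denom_neq0 ki; have := numer_neq0 ki; rewrite /ratio.
have [<- <-] := box_factor_above ltik.
have -> : (nth 0%N s i - nth 0%N s k = (nth 0%N s i - (nth 0%N s k).+1).+1)%N by lia.
set d := (_ - (nth _ s k).+1)%N.
rewrite !strip_factorS => nz1 nz; have := strip_factor_neq0 (k - i) d => nz'.
by field; rewrite nz nz1 nz'.
Qed.

(** Only pairs containing row [k] change. The leading strip of row [k] acts as its pair with the
    empty row of index [N], whence the last factor. *)
Lemma partition_weight_inv_add_box :
  partition_weight_inv N s' = partition_weight_inv N s *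
    ((\prod_(m < N | m != k) ratio m) * numer (row_var q u s N)).
Proof.
(* The change of a pair, extended by 1 to all [(i, m)] so that the double product collapses to the
   pairs with [k]. *)
pose rho (i m : 'I_N) : K :=
  if (i < m)%N then
    if i == k then ratio m else if m == k then ratio i else 1 else 1.
have pairE (i m : 'I_N) : (i < m)%N ->
    pair_factor s' i m = pair_factor s i m * rho i m.
  move=> ltim; rewrite /rho ltim; case: eqP => [ik|/eqP ik].
    by rewrite ik in ltim *; exact: pair_factor_below.
  case: eqP => [mk|/eqP mk].
    by rewrite mk in ltim *; exact: pair_factor_above.
  rewrite mulr1 /pair_factor !nth_add_box.
  by rewrite ![k == _ :> nat]eq_sym !val_eqE (negPf ik) (negPf mk).
have stripE (i : 'I_N) : strip_factor (N - i.+1) (nth 0%N s' i) =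
    strip_factor (N - i.+1) (nth 0%N s i) *
    (if i == k then numer (row_var q u s N) else 1).
  rewrite nth_add_box [k == i :> nat]eq_sym val_eqE; case: eqP => [->|_].
    rewrite add1n strip_factorS -(box_factor_below (ltn_ord k)).1.
    by rewrite [nth 0%N s N]nth_default ?s_size // subn0.
  by rewrite mulr1.
transitivity (\prod_(i < N) ((strip_factor (N - i.+1) (nth 0%N s i) *
    \prod_(m < N | (i < m)%N) pair_factor s i m) *
    ((if i == k then numer (row_var q u s N) else 1) *
    \prod_(m < N) rho i m))).
  apply: eq_bigr => i _; rewrite stripE mulrACA; congr (_ * _).
  rewrite [\prod_(m < N) rho i m](bigID (fun m : 'I_N => i < m)%N) /=.
  rewrite [X in _ * (_ * X)]big1 ?mulr1 => [|m /negPf im].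
    by rewrite -big_split; apply: eq_bigr => m /pairE.
  by rewrite /rho im.
rewrite big_split /=; congr (_ * _); rewrite big_split /= mulrC; congr (_ * _).
  rewrite (bigD1 k) //= (bigD1 k) //= {1}/rho ltnn mul1r.
  rewrite -big_split /=; apply: eq_bigr => i ik.
  rewrite (bigD1 k) //= big1 => [|m mk].
    rewrite mulr1 /rho eqxx (negPf ik).
    have : (i : nat) != k by rewrite val_eqE.
    by rewrite neq_ltn => /orP[lt|lt]; rewrite lt ltnNge (ltnW lt) /= ?mulr1 ?mul1r.
  by rewrite /rho (negPf ik) (negPf mk) if_same.
by rewrite -big_mkcond big_pred1_eq.
Qed.

Lemma partition_weight_inv_neq0 M r : partition_weight_inv M r != 0.
Proof.
apply/prodf_neq0 => i _; rewrite mulf_neq0 ?strip_factor_neq0 //.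
by apply/prodf_neq0 => m _; rewrite mulf_neq0 ?invr_neq0 ?strip_factor_neq0.
Qed.

(** Each [ratio m] is a factor of [rem_coef] over a factor of [add_coef], and [numer] at row [N]
    consists of the two extra factors, since [t2 x_l = x_N] for the empty row [l]. *)
Lemma box_weight_add_box (l : 'I_N) : N = l.+1 -> nth 0%N s l = 0%N ->
  box_weight q u s * add_coef (fun m : 'I_N => row_var q u s m) t2 l k =
  box_weight q u s' *
    rem_coef (fun m : 'I_N => row_var q u s' m) t2 (t2 ^+ N / u) k.
Proof.
move=> Nl sl; rewrite !box_weightE // size_add_box s_size.
rewrite -/(partition_weight_inv N s) -/(partition_weight_inv N s').
have bE : t2 ^+ N / u = row_var q u s N.
  by rewrite /row_var nth_default ?s_size // expr0 mul1r t2_exp.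
have lE : t2 * row_var q u s l = row_var q u s N.
  by rewrite -bE /row_var sl expr0 mul1r -t2_exp mulrA -exprS -Nl.
rewrite partition_weight_inv_add_box /add_coef /rem_coef lE bE.
rewrite row_var_add_box eqxx.
set b := row_var q u s N; set xk := row_var q u s k.
have nb : numer b != 0 by rewrite -(box_factor_below (ltn_ord k)).1 box_factor_neq0.
have prodE : \prod_(m < N | m != k) ((1 - t2 * (q * xk) / row_var q u s' m) /
     (1 - q * xk / row_var q u s' m)) =
   (\prod_(m < N | m != k) ratio m) *
   \prod_(m < N | m != k) ((1 - t2 * row_var q u s m / xk) / (1 - row_var q u s m / xk)).
  rewrite -big_split; apply: eq_bigr => m mk; rewrite /= row_var_add_box val_eqE (negPf mk).
  have := numer_neq0 mk; have := denom_neq0 mk; rewrite /ratio /numer /denom -/xk.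
  rewrite !mulf_eq0 !negb_or => /andP[] + + /andP[].
  set d1 := 1 - t2 * _ / xk; set d2 := 1 - q * xk / _.
  set n1 := 1 - _ / xk; set n2 := 1 - _ / _ => d1_neq0 d2_neq0 n1_neq0 n2_neq0.
  by field; rewrite d1_neq0 d2_neq0 n1_neq0.
rewrite prodE; move: nb; rewrite /numer mulf_eq0 negb_or -/xk => /andP[nb1 nb2].
have rnz : \prod_(m < N | m != k) ratio m != 0.
  by apply/prodf_neq0 => m mk; rewrite mulf_neq0 ?numer_neq0 ?invr_neq0 ?denom_neq0.
have wnz := partition_weight_inv_neq0 N s.
set A := \prod_(m < N | m != k) ratio m in rnz *.
set n1 := 1 - b / xk in nb1 *; set n2 := 1 - _ / b in nb2 *.
clearbody n1 n2 A; field; rewrite ?wnz ?rnz ?nb1 ?nb2 //.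
Qed.

End AddBox.
End BoxWeight.

(** * Padded partitions and the bijection adding a box in a given row *)

Section Partitions.
Implicit Types (s : seq nat) (N n k : nat).

(** The number [N] of rows is independent of [n], so that partitions of [n] and [n + 1] can be
    sequences of the same length. *)
Definition partitions N n : seq (seq nat) :=
  [seq map val eta | eta : N.-tuple 'I_n.+1 in
    [pred eta : N.-tuple 'I_n.+1 |
      sorted geq (map val eta) && (sumn (map val eta) == n)]].

Lemma mem_partitions N n s :
  (s \in partitions N n) = [&& size s == N, sorted geq s & sumn s == n].
Proof.
apply/imageP/and3P => [[eta /andP[eta_sorted eta_sum] ->]|].
  by rewrite size_map size_tuple.
move=> [/eqP s_size s_sorted s_sum].
have e : size (map (@inord n) s) == N by rewrite size_map s_size.
have sE : map val (Tuple e) = s.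
  rewrite /= -map_comp -[RHS]map_id; apply/eq_in_map => a sa /=.
  by rewrite inordK // ltnS -(eqP s_sum) sumnE (big_rem a) //= leq_addr.
by exists (Tuple e); rewrite ?inE sE ?s_sorted.
Qed.

Lemma partitions_uniq N n : uniq (partitions N n).
Proof.
rewrite map_inj_in_uniq ?enum_uniq // => eta1 eta2 _ _ /inj_map.
by move=> /(_ val_inj)/val_inj.
Qed.

Lemma part_length_sum s : (part_length s <= sumn s)%N.
Proof.
elim: s => //= a s IHs; rewrite /part_length /conj_part /=.
by apply: leq_add => //; case: a.
Qed.

Lemma nth_pad s p m : nth 0%N (s ++ nseq p 0%N) m = nth 0%N s m.
Proof.
rewrite nth_cat nth_nseq if_same; case: ltnP => // sm.
by rewrite nth_default.
Qed.

Lemma partitions_pad N n : (n <= N)%N ->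
  perm_eq [seq s ++ nseq (N - n) 0%N | s <- partitions n n] (partitions N n).
Proof.
move=> leqnN; apply: uniq_perm (partitions_uniq _ _) _.
  rewrite map_inj_in_uniq ?partitions_uniq // => s1 s2.
  rewrite !mem_partitions => /andP[/eqP s1n _] /andP[/eqP s2n _] /eqP.
  by rewrite eqseq_cat ?s1n ?s2n // => /andP[/eqP].
move=> s; rewrite mem_partitions; apply/mapP/and3P => [[s1 + ->]|].
  rewrite mem_partitions => /and3P[/eqP s1_size s1_sorted /eqP s1_sum]; split.
  - by rewrite size_cat size_nseq s1_size subnKC.
  - apply/(sortedP 0%N) => i _; rewrite /= !nth_pad.
    exact: sorted_nth_le.
  by rewrite sumn_cat sumn_nseq mul0n addn0 s1_sum.
move=> [/eqP s_size s_sorted /eqP s_sum].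
have s0 m : (n <= m)%N -> nth 0%N s m = 0%N.
  move=> lenm; apply: part_length_gt => //.
  by rewrite (leq_trans (part_length_sum s)) ?s_sum.
have sE : take n s ++ nseq (N - n) 0%N = s.
  apply: (@eq_from_nth _ 0%N).
    by rewrite size_cat size_nseq size_takel ?s_size // subnKC.
  move=> i _; rewrite nth_pad; case: (ltnP i n) => [lti|leni].
    by rewrite nth_take.
  by rewrite s0 // nth_default // size_takel ?s_size.
exists (take n s); last by rewrite sE.
move: s_sum; rewrite -{1}sE sumn_cat sumn_nseq mul0n addn0 => take_sum.
by rewrite mem_partitions take_sorted // size_takel ?s_size // take_sum !eqxx.
Qed.

Lemma sumn_incr s k : (k < size s)%N -> sumn (incr_nth s k) = (sumn s).+1.
Proof. by elim: s k => //= a s IHs [|k] //= ks; rewrite IHs // addnS. Qed.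

Lemma sorted_incr s k : sorted geq s -> (k < size s)%N ->
  sorted geq (incr_nth s k) = (k == 0%N) || (nth 0%N s k < nth 0%N s k.-1)%N.
Proof.
move=> s_sorted ks; apply/(sortedP 0%N)/idP => [|cond i].
  rewrite size_incr_nth ks => sortedP; case: k ks sortedP => //= k ks /(_ k ks).
  by rewrite /= !nth_incr_nth eqxx gtn_eqF.
rewrite size_incr_nth ks => lti; rewrite /= !nth_incr_nth.
have := @sorted_nth_le s i i.+1 s_sorted (leqnSn i).
case: (eqVneq k i.+1) cond => [->|_] /=; first by rewrite gtn_eqF //; lia.
by move=> _; lia.
Qed.

(** The inverse lowers part [k] by one, which is possible when the next part is smaller; for
    [k = N - 1] that next part is the default 0. *)
Lemma partitions_incr N n k : (k < N)%N ->
  perm_eq [seq incr_nth s k | s <- partitions N n & sorted geq (incr_nth s k)]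
    [seq s <- partitions N n.+1 | nth 0%N s k.+1 < nth 0%N s k]%N.
Proof.
move=> kN; apply: uniq_perm; last first.
- move=> s'; rewrite mem_filter mem_partitions; apply/mapP/and4P => [[s]|].
    rewrite mem_filter mem_partitions.
    move=> /and4P[s'_sorted /eqP s_size s_sorted /eqP s_sum] ->; split=> //.
    + rewrite !nth_incr_nth eqxx ltn_eqF // add0n add1n ltnS.
      exact: sorted_nth_le.
    + by rewrite size_incr_nth s_size kN.
    by rewrite sumn_incr ?s_sum ?s_size.
  move=> [s'k /eqP s'_size s'_sorted /eqP s'_sum].
  pose s := set_nth 0%N s' k (nth 0%N s' k).-1.
  have s_size : size s = N by rewrite size_set_nth s'_size (maxn_idPr _).
  have sE : incr_nth s k = s'.
    apply: (@eq_from_nth _ 0%N); first by rewrite size_incr_nth s_size kN.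
    move=> i _; rewrite nth_incr_nth nth_set_nth /= [k == i]eq_sym.
    by case: eqP => [->|//]; rewrite add1n prednK // (leq_ltn_trans _ s'k).
  exists s => //; rewrite mem_filter mem_partitions sE s'_sorted s_size eqxx /=.
  rewrite -eqSS -(@sumn_incr s k) ?s_size // sE s'_sum eqxx andbT.
  apply/(sortedP 0%N) => i _; rewrite /= !nth_set_nth /=.
  have := @sorted_nth_le s' i i.+1 s'_sorted (leqnSn i).
  case: (eqVneq i k) => [->|ik]; first by rewrite gtn_eqF // => _; lia.
  by case: (eqVneq i.+1 k) => [<-|] //; lia.
- exact: filter_uniq (partitions_uniq _ _).
rewrite map_inj_in_uniq ?filter_uniq ?partitions_uniq // => s1 s2.
rewrite !mem_filter !mem_partitions => /and3P[_ /eqP s1_size _].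
move=> /and3P[_ /eqP s2_size _] s12; apply: (@eq_from_nth _ 0%N).
  by rewrite s1_size.
move=> i _; have := congr1 (fun s => nth 0%N s i) s12.
by rewrite !nth_incr_nth => /addnI.
Qed.

End Partitions.

(** * Recursions for the coefficients of [Z] *)

Section PartitionSums.
Variables (K : fieldType) (q u : K).
Hypothesis charK0 : [pchar K] =i pred0.
Hypotheses (q_neq0 : q != 0) (u_neq0 : u != 0).
Hypothesis qu_generic : forall a b : int, q ^ a * u ^ b = 1 -> a = 0 /\ b = 0.

Let t2 : K := u ^- 2.
Let x (s : seq nat) (m : nat) : K := row_var q u s m.

Lemma x_t2E s m : x s m = q ^+ nth 0%N s m * (t2 ^+ m / u).
Proof. by rewrite t2_exp. Qed.

Lemma x_neq0 s m : x s m != 0.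
Proof. exact: row_var_neq0. Qed.

(** No box fits when [s_(k-1) = s_k] with [k > 0]; then [t2 x_(k-1) = x_k], and the numerator of
    index [k - 1] vanishes. *)
Lemma add_coef_eq0 N (s : seq nat) (k : 'I_N) l : size s = N -> sorted geq s ->
  ~~ sorted geq (incr_nth s k) ->
  add_coef (fun m : 'I_N => x s m) t2 l k = 0.
Proof.
move=> s_size s_sorted; rewrite sorted_incr ?s_size // negb_or -leqNgt.
move=> /andP[k0 le_sk]; have ltkN : (k.-1 < N)%N by have := ltn_ord k; lia.
rewrite /add_coef (bigD1 (Ordinal ltkN)) /=; last first.
  by rewrite -val_eqE /=; move: k0; case: (nat_of_ord k) => //= n _; rewrite ltn_eqF.
have -> : t2 * x s k.-1 = x s k.
  rewrite !x_t2E; have -> : nth 0%N s k.-1 = nth 0%N s k.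
    by apply/eqP; rewrite eqn_leq le_sk sorted_nth_le ?leq_pred.
  have -> : t2 ^+ k = t2 * t2 ^+ k.-1 by rewrite -exprS prednK ?lt0n.
  by ring.
by rewrite divff ?x_neq0 // subrr !mul0r.
Qed.

(** Here [s_(k+1) = s_k] gives [t2 x_k = x_(k+1)], which kills the factor of index [k + 1], or the
    extra factor when [k] is the last row. *)
Lemma rem_coef_eq0 N (s : seq nat) (k : 'I_N) : size s = N -> sorted geq s ->
  ~~ (nth 0%N s k.+1 < nth 0%N s k)%N ->
  rem_coef (fun m : 'I_N => x s m) t2 (t2 ^+ N / u) k = 0.
Proof.
move=> s_size s_sorted; rewrite -leqNgt => le_sk.
have sk : nth 0%N s k.+1 = nth 0%N s k.
  by apply/eqP; rewrite eqn_leq le_sk sorted_nth_le.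
have xk : t2 * x s k = x s k.+1 by rewrite !x_t2E sk exprS; ring.
rewrite /rem_coef; have [ltkN|leNk] := ltnP k.+1 N.
  rewrite (bigD1 (Ordinal ltkN)) /=; last by rewrite -val_eqE /= gtn_eqF.
  by rewrite xk divff ?x_neq0 // subrr !mul0r.
have NE : N = k.+1 by apply/eqP; rewrite eqn_leq leNk ltn_ord.
have -> : t2 ^+ N / u = x s k.+1.
  by rewrite x_t2E nth_default ?s_size // expr0 mul1r [in LHS]NE.
by rewrite xk divff ?x_neq0 // subrr mulr0.
Qed.

(** Vanishing coefficients reduce both sides to boxes that can be added or removed, and
    [partitions_incr] matches these. With [n + 2] rows the last row [l] of a partition of [n] is
    empty. *)
Lemma add_rem_exchange n (N := n.+2) (l := ord_max : 'I_N)
    (D D' : nat -> seq nat -> K) :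
  (forall s k, size s = N -> (k < N)%N -> D k s = D' k (incr_nth s k)) ->
  \sum_(s <- partitions N n) box_weight q u s *
    (\sum_(k < N) add_coef (fun m : 'I_N => x s m) t2 l k * D k s) =
  \sum_(s <- partitions N n.+1) box_weight q u s *
    (\sum_(k < N) rem_coef (fun m : 'I_N => x s m) t2 (t2 ^+ N / u) k * D' k s).
Proof.
move=> DD'.
under eq_bigr do rewrite mulr_sumr.
under [RHS]eq_bigr do rewrite mulr_sumr.
rewrite exchange_big [RHS]exchange_big; apply: eq_bigr => k _ /=.
rewrite [LHS](bigID (fun s => sorted geq (incr_nth s k))) /=.
rewrite [X in _ + X]big_seq_cond [X in _ + X]big1 ?addr0; last first.
  move=> s; rewrite mem_partitions => /andP[/and3P[/eqP s_size s_sorted _]].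
  by move=> s'_sorted; rewrite add_coef_eq0 // mul0r mulr0.
rewrite [RHS](bigID (fun s => nth 0%N s k.+1 < nth 0%N s k)%N) /=.
rewrite [X in _ = _ + X]big_seq_cond [X in _ = _ + X]big1 ?addr0; last first.
  move=> s; rewrite mem_partitions => /andP[/and3P[/eqP s_size s_sorted _]].
  by move=> s'_sorted; rewrite rem_coef_eq0 // mul0r mulr0.
rewrite -[RHS]big_filter -(perm_big _ (partitions_incr n (ltn_ord k))) [RHS]big_map.
rewrite big_filter big_seq_cond [RHS]big_seq_cond; apply: eq_bigr => s.
rewrite mem_partitions => /andP[/and3P[/eqP s_size s_sorted /eqP s_sum]] s'_sorted.
rewrite mulrA [RHS]mulrA -DD' //; congr (_ * _).
apply: box_weight_add_box => //.
apply: part_length_gt => //=.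
by rewrite (leq_trans (part_length_sum s)) ?s_sum.
Qed.

Lemma rest_incr s k r : (k < size s)%N ->
  rest q u s k r = rest q u (incr_nth s k) k r.
Proof.
move=> ks; have s'_size : size (incr_nth s k) = size s by rewrite size_incr_nth ks.
rewrite /rest s'_size; apply: eq_fps_mul => // i; congr ((_ : {poly K})`_i).
apply: eq_bigr => m mk; congr (1 + _ *: _).
by rewrite /row_var nth_incr_nth eq_sym (negPf mk).
Qed.

Lemma add_sumN N (s : seq nat) (l : 'I_N) r :
  size s = N -> sorted geq s -> N = l.+1 -> nth 0%N s l = 0%N ->
  \sum_k (1 - t2) * add_coef (fun m : 'I_N => x s m) t2 l k * rest q u s k r
  = t2 ^+ r * esp q u s r.
Proof. by move=> sN; case: N / sN l => l; exact: add_sum. Qed.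

Lemma rem_sumN N (s : seq nat) r : size s = N -> sorted geq s ->
  \sum_k (1 - t2) * rem_coef (fun m : 'I_N => x s m) t2 (t2 ^+ N / u) k
     * rest q u s k r
  = u * (t2 - t2 ^- r) * esp q u s r.+1 + esp q u s r.
Proof. by move=> sN; case: N / sN; exact: rem_sum. Qed.

Definition moment N n r r' : K :=
  \sum_(s <- partitions N n) box_weight q u s * (esp q u s r * esp q u s r').

Lemma esp0 s : esp q u s 0 = 1.
Proof. exact: (@esymf0 K K^o charK0 _). Qed.

(** The exchanged summand is a multiple of [rest], which does not involve [x_k] and so is unchanged
    by a box in row [k]. *)
Lemma moment1_rec n r (N := n.+2) :
  t2 ^+ r * moment N n r 0 =
  u * (t2 - t2 ^- r) * moment N n.+1 r.+1 0 + moment N n.+1 r 0.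
Proof.
pose D k s := (1 - t2) * rest q u s k r.
have DE s k : size s = N -> (k < N)%N -> D k s = D k (incr_nth s k).
  by move=> s_size kN; rewrite /D rest_incr // s_size.
have E := add_rem_exchange DE; rewrite /D in E.
rewrite /moment !mulr_sumr -big_split /=.
transitivity (\sum_(s <- partitions N n) box_weight q u s *
    (\sum_(k < N) add_coef (fun m : 'I_N => x s m) t2 ord_max k *
       ((1 - t2) * rest q u s k r))).
  apply: eq_big_seq => s; rewrite mem_partitions.
  move=> /and3P[/eqP s_size s_sorted /eqP s_sum].
  under eq_bigr do rewrite mulrCA mulrA.
  rewrite add_sumN // ?esp0; first by ring.
  apply: part_length_gt => //=.
  by rewrite (leq_trans (part_length_sum s)) ?s_sum.
rewrite E; apply: eq_big_seq => s; rewrite mem_partitions.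
move=> /and3P[/eqP s_size s_sorted /eqP s_sum].
under eq_bigr do rewrite mulrCA mulrA.
by rewrite rem_sumN // esp0; ring.
Qed.

(** The exchanged summand is a multiple of [rest_r e_r' - e_r rest_r']. By [esp_rest] its terms free
    of [x_k] cancel, leaving [x_k] times a function [B] of the other variables, so a new box
    multiplies it by [q]. *)
Lemma moment2_rec n r r' (N := n.+2) :
  q * (t2 ^+ r - t2 ^+ r') * moment N n r r' =
  u * ((t2 - t2 ^- r) * moment N n.+1 r.+1 r' -
       (t2 - t2 ^- r') * moment N n.+1 r r'.+1).
Proof.
pose pre s k r := if r is r1.+1 then rest q u s k r1 else 0.
pose B k s := rest q u s k r * pre s k r' - pre s k r * rest q u s k r'.
have BE k s : size s = N -> sorted geq s -> (k < N)%N -> x s k * B k s =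
    rest q u s k r * esp q u s r' - esp q u s r * rest q u s k r'.
  move=> s_size s_sorted kN.
  have espE r1 : esp q u s r1 = rest q u s k r1 + x s k * pre s k r1.
    by apply: esp_rest => //; rewrite s_size.
  by rewrite /B !espE; ring.
pose D k s := (1 - t2) * (q * (x s k * B k s)).
pose D' k s := (1 - t2) * (x s k * B k s).
have DE s k : size s = N -> (k < N)%N -> D k s = D' k (incr_nth s k).
  move=> s_size kN; rewrite /D /D'.
  congr (_ * _); rewrite mulrA; congr (_ * _).
    by rewrite /x /row_var nth_incr_nth eqxx add1n exprS mulrA.
  rewrite /B /pre; congr (_ * _ - _ * _); rewrite -?rest_incr ?s_size //.
    by case: (r') => // r1; rewrite -rest_incr ?s_size.
  by case: (r) => // r1; rewrite -rest_incr ?s_size.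
have E := add_rem_exchange DE; rewrite /D /D' in E.
rewrite /moment !mulr_sumr -sumrB mulr_sumr.
transitivity (\sum_(s <- partitions N n) box_weight q u s *
    (\sum_(k < N) add_coef (fun m : 'I_N => x s m) t2 ord_max k *
       ((1 - t2) * (q * (x s k * B k s))))).
  apply: eq_big_seq => s; rewrite mem_partitions.
  move=> /and3P[/eqP s_size s_sorted /eqP s_sum].
  have sl : nth 0%N s (ord_max : 'I_N) = 0%N.
    apply: part_length_gt => //=.
    by rewrite (leq_trans (part_length_sum s)) ?s_sum.
  transitivity (box_weight q u s * (q * (
     (\sum_k (1 - t2) * add_coef (fun m : 'I_N => x s m) t2 ord_max k * rest q u s k r)
        * esp q u s r' -
     esp q u s r * (\sum_k (1 - t2) * add_coef (fun m : 'I_N => x s m) t2 ord_max k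
        * rest q u s k r')))).
    by rewrite !add_sumN //; ring.
  congr (_ * _); rewrite mulr_suml mulr_sumr -sumrB mulr_sumr.
  apply: eq_bigr => k _; rewrite BE //; ring.
rewrite E; apply: eq_big_seq => s; rewrite mem_partitions.
move=> /and3P[/eqP s_size s_sorted /eqP s_sum].
transitivity (box_weight q u s * (
   (\sum_k (1 - t2) * rem_coef (fun m : 'I_N => x s m) t2 (t2 ^+ N / u) k * rest q u s k r)
      * esp q u s r' -
   esp q u s r * (\sum_k (1 - t2) * rem_coef (fun m : 'I_N => x s m) t2 (t2 ^+ N / u) k
      * rest q u s k r'))).
  congr (_ * _); rewrite mulr_suml mulr_sumr -sumrB.
  by apply: eq_bigr => k _; rewrite BE //; ring.
by rewrite !rem_sumN //; ring.
Qed.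

Lemma schur_spec_col r s : schur_spec q u (col_part r) s = esp q u s r.
Proof. exact: (@schur_col K K^o charK0 _ r). Qed.

Lemma conj_part_pad s p j : (0 < j)%N ->
  conj_part (s ++ nseq p 0%N) j = conj_part s j.
Proof.
by move=> j0; rewrite /conj_part count_cat count_nseq leqNgt j0 mul0n addn0.
Qed.

Lemma box_weight_pad s p : box_weight q u (s ++ nseq p 0%N) = box_weight q u s.
Proof.
rewrite /box_weight /part_length conj_part_pad //; apply: eq_bigr => i _.
rewrite /part nth_pad; apply: eq_big_nat => j /andP[j0 _].
by rewrite conj_part_pad.
Qed.

Lemma esp_pad s p r : esp q u (s ++ nseq p 0%N) r = esp q u s r.
Proof.
apply: (@eq_esymf K K^o charK0) => n; rewrite /psum_spec /part_length conj_part_pad //.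
by congr (_ *: _ + _); apply: eq_bigr => i _; rewrite /part nth_pad.
Qed.

Lemma Zser_col N r r' n : (n <= N)%N ->
  Zser q u (col_part r) (col_part r') n = moment N n r r'.
Proof.
move=> nN; rewrite /moment -(perm_big _ (partitions_pad nN)) big_map.
rewrite /Zser big_image; apply: eq_bigr => eta _.
rewrite !schur_spec_col box_weight_pad !esp_pad mulrC; ring.
Qed.

Lemma Zser1_rec r n :
  (if n is n'.+1 then t2 ^+ r * Zser q u (col_part r) (col_part 0) n' else 0) =
  u * (t2 - t2 ^- r) * Zser q u (col_part r.+1) (col_part 0) n +
  Zser q u (col_part r) (col_part 0) n.
Proof.
case: n => [|n].
  have moment0 r1 : moment 0 0 r1 0 = box_weight q u [::] * (esp q u [::] r1 * 1).
    rewrite /moment; have -> : partitions 0 0 = [:: [::]].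
      apply/perm_small_eq => //; apply: uniq_perm => //; first exact: partitions_uniq.
      by move=> s; rewrite mem_partitions inE; case: s.
    by rewrite big_seq1 esp0.
  rewrite !(@Zser_col 0) // !moment0.
  (* For the empty partition with no rows the sum over boxes is empty, and [rem_sumN] becomes a
     relation between values of [esp]. *)
  have := @rem_sumN 0 [::] r (erefl _) (erefl _); rewrite big_ord0 => E.
  by rewrite !mulr1 mulrCA -mulrDr -E mulr0.
rewrite -[LHS]/(t2 ^+ r * Zser q u (col_part r) (col_part 0) n).
have le1 : (n <= n.+2)%N := leqW (leqnSn n).
by rewrite !(@Zser_col n.+2) ?le1 ?leqnSn // moment1_rec.
Qed.

Lemma Zser2_rec r r' n :
  (if n is n'.+1 then
     q * (t2 ^+ r - t2 ^+ r') * Zser q u (col_part r) (col_part r') n' else 0) =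
  u * ((t2 - t2 ^- r) * Zser q u (col_part r.+1) (col_part r') n -
       (t2 - t2 ^- r') * Zser q u (col_part r) (col_part r'.+1) n).
Proof.
case: n => [|n].
  have moment0 r1 r2 : moment 0 0 r1 r2 =
      box_weight q u [::] * (esp q u [::] r1 * esp q u [::] r2).
    rewrite /moment; have -> : partitions 0 0 = [:: [::]].
      apply/perm_small_eq => //; apply: uniq_perm => //; first exact: partitions_uniq.
      by move=> s; rewrite mem_partitions inE; case: s.
    by rewrite big_seq1.
  rewrite !(@Zser_col 0) // !moment0.
  have := @rem_sumN 0 [::] r (erefl _) (erefl _); rewrite big_ord0 => /esym E.
  have := @rem_sumN 0 [::] r' (erefl _) (erefl _); rewrite big_ord0 => /esym E'.
  have : box_weight q u [::] * ((u * (t2 - t2 ^- r) * esp q u [::] r.+1 +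
     esp q u [::] r) * esp q u [::] r' - esp q u [::] r *
     (u * (t2 - t2 ^- r') * esp q u [::] r'.+1 + esp q u [::] r')) = 0.
    by rewrite E E' mul0r mulr0 subrr mulr0.
  by move=> <-; ring.
rewrite -[LHS]/(q * (t2 ^+ r - t2 ^+ r') * Zser q u (col_part r) (col_part r') n).
have le1 : (n <= n.+2)%N := leqW (leqnSn n).
by rewrite !(@Zser_col n.+2) ?le1 ?leqnSn // moment2_rec.
Qed.

End PartitionSums.

(** * The product formula: its recursions, the quotient by [Z], and the degree *)

Section QuotientPolynomial.
Variables (K : fieldType) (q u : K).
Hypothesis charK0 : [pchar K] =i pred0.
Hypotheses (q_neq0 : q != 0) (u_neq0 : u != 0).
Hypothesis qu_generic : forall a b : int, q ^ a * u ^ b = 1 -> a = 0 /\ b = 0.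

Let t2 : K := u ^- 2.
Let a (r s : nat) : {poly K} := esym_Q q u s (col_part r).
Let p (r n : nat) : {poly K} := psum_spec q u ('X : {poly K}) 1 (col_part r) n.

Lemma psum_col r n : p r n =
  ((q ^+ n - 1) * \sum_(m < r) u ^- (n * (2 * m + 1))) *: 'X^n
  + theta u n *: ('X^n - 1).
Proof.
have ss : sorted geq (col_part r).
  apply/(sortedP 0%N) => i _; rewrite /= !nth_nseq.
  by case: (ltnP i.+1 r) => // /ltnW ->.
rewrite /p psum_spec_rows // expr1n; congr (_ *: _ + _).
rewrite size_nseq mulr_sumr; apply: eq_bigr => m _.
rewrite /row_var nth_nseq ltn_ord expr1 exprMn exprVn -exprM [(n * _)%N]mulnC.
by ring.
Qed.

(** Passing from [(1^r)] to [(1^(r+1))] multiplies the variable of row [r], counted from 0, by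
    [q]. *)
Lemma psum_col_top r n : (0 < n)%N ->
  p r.+1 n + (u ^- (2 * r + 1) *: 'X) ^+ n = p r n + ((q / u ^+ (2 * r + 1)) *: 'X) ^+ n.
Proof.
move=> n0; rewrite !psum_col big_ord_recr /= !exprZn exprMn -exprVn -!exprVn -!exprM.
rewrite [(n * (2 * r + 1))%N]mulnC -!mul_polyC !polyCM !polyCD.
by ring.
Qed.

(** The first row is split off: the remaining rows of [(1^(r+1))] are those of [(1^r)] scaled by
    [t2]. The term in [u^-1] comes from [L = 1]. *)
Lemma psum_col_shift r n : (0 < n)%N ->
  p r.+1 n + (u^-1)%:P ^+ n = t2%:P ^+ n * p r n + ((u^-1 * q) *: 'X) ^+ n.
Proof.
move=> n0; rewrite !psum_col big_ord_recl {1}(theta_shift q_neq0 u_neq0 qu_generic n0).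
have -> : \sum_(i < r) u ^- (n * (2 * lift ord0 i + 1)) =
    t2 ^+ n * \sum_(m < r) u ^- (n * (2 * m + 1)).
  rewrite mulr_sumr; apply: eq_bigr => m _.
  rewrite /t2 -!exprVn -!exprM -exprD /bump /=.
  congr (_ ^+ _); rewrite [(2 * n)%N]mulnC -mulnDr; congr (n * _)%N; rewrite /bump; lia.
rewrite muln0 add0n muln1 -/t2 !exprZn exprMn -!exprVn -!mul_polyC.
rewrite !(polyCM, polyCD, polyC_exp, polyCN, polyCB).
by ring.
Qed.

Lemma psum_empty_shift n : (0 < n)%N ->
  p 0 n + (u^-1)%:P ^+ n = t2%:P ^+ n * p 0 n + (u^-1 *: 'X) ^+ n.
Proof.
move=> n0; rewrite !psum_col big_ord0 mulr0 scale0r add0r.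
rewrite {1}(theta_shift q_neq0 u_neq0 qu_generic n0).
rewrite -/t2 !exprZn -!exprVn -!mul_polyC.
rewrite !(polyCM, polyCD, polyC_exp, polyCN, polyCB).
by ring.
Qed.

Lemma esym_top r s : a r.+1 s.+1 + (u ^- (2 * r + 1) *: 'X) * a r.+1 s =
  a r s.+1 + ((q / u ^+ (2 * r + 1)) *: 'X) * a r s.
Proof.
rewrite /a /esym_Q -!(esymfD_geom charK0); apply: (eq_esymf charK0) => n.
exact: psum_col_top.
Qed.

Lemma esym_shift r s : a r.+1 s.+1 + (u^-1)%:P * a r.+1 s =
  t2%:P ^+ s.+1 * a r s.+1 + ((u^-1 * q) *: 'X) * (t2%:P ^+ s * a r s).
Proof.
rewrite /a /esym_Q -!(esymf_scale charK0) -!(esymfD_geom charK0).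
by apply: (eq_esymf charK0) => n; exact: psum_col_shift.
Qed.

Lemma esym_empty s : a 0 s.+1 + (u^-1)%:P * a 0 s =
  t2%:P ^+ s.+1 * a 0 s.+1 + (u^-1 *: 'X) * (t2%:P ^+ s * a 0 s).
Proof.
rewrite /a /esym_Q -!(esymf_scale charK0) -!(esymfD_geom charK0).
by apply: (eq_esymf charK0) => n; exact: psum_empty_shift.
Qed.

Lemma esym_Q0 r : a r 0 = 1.
Proof. exact: esymf0 charK0 _. Qed.

(** Exhibits [a 0 s] as a multiple of the product of the [t2^i Q - 1] with [i < s]. *)
Lemma esym_empty_rec s :
  (u * (1 - t2 ^+ s.+1)) *: a 0 s.+1 = (t2 ^+ s *: 'X - 1) * a 0 s.
Proof.
have uK : u%:P * (u^-1)%:P = 1 :> {poly K} by rewrite -polyCM mulfV.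
have := congr1 (fun z => u%:P * (z - t2%:P ^+ s.+1 * a 0 s.+1 - (u^-1)%:P * a 0 s))
  (esym_empty s).
rewrite -!mul_polyC !(polyCM, polyCB, polyC_exp) => E.
transitivity (u%:P * (a 0 s.+1 + (u^-1)%:P * a 0 s - t2%:P ^+ s.+1 * a 0 s.+1 -
   (u^-1)%:P * a 0 s)); first by ring.
rewrite E; transitivity ((u%:P * (u^-1)%:P) * (t2%:P ^+ s * 'X - 1) * a 0 s).
  by ring.
by rewrite uK mul1r.
Qed.

(** Elimination of [a r.+1 s.+1] between [esym_top] and [esym_shift]. *)
Lemma esym_rec r s : (t2 ^+ r *: 'X - 1) * a r.+1 s =
  (u * (1 - t2 ^+ s.+1)) *: a r s.+1 + (q * (t2 ^+ r - t2 ^+ s)) *: ('X * a r s).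
Proof.
have uK : u%:P * (u^-1)%:P = 1 :> {poly K} by rewrite -polyCM mulfV.
have cE : u ^- (2 * r + 1) = t2 ^+ r * u^-1.
  by rewrite -t2_exp.
have := esym_top r s; have := esym_shift r s.
rewrite -!mul_polyC cE !(polyCM, polyCB, polyC_exp) => E1 E2.
have E : u%:P * ((t2%:P ^+ r * (u^-1)%:P * 'X) * a r.+1 s - (u^-1)%:P * a r.+1 s) =
  u%:P * ((a r s.+1 + q%:P * (t2%:P ^+ r * (u^-1)%:P) * 'X * a r s) -
  (t2%:P ^+ s.+1 * a r s.+1 + (u^-1)%:P * q%:P * 'X * (t2%:P ^+ s * a r s))).
  rewrite -E2 -E1; ring.
transitivity ((u%:P * (u^-1)%:P) * (t2%:P ^+ r * 'X - 1) * a r.+1 s).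
  by rewrite uK mul1r ?polyC1.
transitivity (u%:P * ((t2%:P ^+ r * (u^-1)%:P * 'X) * a r.+1 s - (u^-1)%:P * a r.+1 s)).
  by ring.
rewrite E; transitivity (u%:P * (1 - t2%:P ^+ s.+1) * a r s.+1 +
  (u%:P * (u^-1)%:P) * (q%:P * (t2%:P ^+ r - t2%:P ^+ s)) * ('X * a r s)).
  by ring.
by rewrite uK mul1r ?polyC1.
Qed.

Lemma gcolS r : gcol u r.+1 = - (t2 ^+ r * gcol u r).
Proof.
rewrite /gcol exprS mulN1r mulNr; congr (- _).
have -> : ((r.+1 * (r.+1 - 1))./2 = (r * (r - 1))./2 + r)%N.
  have -> : (r.+1 * (r.+1 - 1) = r * (r - 1) + r.*2)%N.
    by case: r => // r; rewrite !subn1 /= -muln2 -mulnDr addn2 mulnC.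
  by rewrite halfD odd_double andbF doubleK.
by rewrite exprD invfM /t2 exprVn; ring.
Qed.

Lemma gcol_neq0 r : gcol u r != 0.
Proof. by rewrite mulf_neq0 ?invr_neq0 ?expf_neq0 ?oppr_eq0 ?oner_neq0. Qed.

Definition quotient_poly (r s : nat) : {poly K} :=
  (gcol u r * gcol u s) *: (a 0 r * a r s).

Let P := quotient_poly.

Lemma gcol_shift r : u * (t2 - t2 ^- r) * gcol u r.+1 = u * (1 - t2 ^+ r.+1) * gcol u r.
Proof.
have := t2_neq0 u_neq0; rewrite -/t2 => t2n.
rewrite gcolS exprS; field; exact: expf_neq0.
Qed.

Lemma quotient_poly_rec1 s :
  (u * (t2 - t2 ^- s)) *: P 0 s.+1 + P 0 s = t2 ^+ s *: ('X * P 0 s).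
Proof.
rewrite /P /quotient_poly esym_Q0 !mul1r.
transitivity ((gcol u 0 * gcol u s) *:
    ((u * (1 - t2 ^+ s.+1)) *: a 0 s.+1 + a 0 s)).
  rewrite scalerDr !scalerA; congr (_ *: _ + _).
  by rewrite mulrCA gcol_shift; ring.
rewrite esym_empty_rec mulrBl mul1r subrK.
by rewrite -!mul_polyC !(polyCM, polyC_exp); ring.
Qed.

(** The counterpart of [Zser2_rec], with ['X] as index shift: the factor [t2^r Q - 1] that
    [a 0 r.+1] contributes is the one on the left of [esym_rec]. *)
Lemma quotient_poly_rec2 r s :
  (u * (t2 - t2 ^- r)) *: P r.+1 s - (u * (t2 - t2 ^- s)) *: P r s.+1
  = (q * (t2 ^+ r - t2 ^+ s)) *: ('X * P r s).
Proof.
rewrite /P /quotient_poly !scalerA mulrA gcol_shift.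
rewrite [_ * (gcol u r * _)]mulrCA gcol_shift.
transitivity ((gcol u r * gcol u s) *: (a 0 r *
   ((t2 ^+ r *: 'X - 1) * a r.+1 s - (u * (1 - t2 ^+ s.+1)) *: a r s.+1))).
  transitivity ((gcol u r * gcol u s) *: (
    ((u * (1 - t2 ^+ r.+1)) *: a 0 r.+1) * a r.+1 s
    - a 0 r * ((u * (1 - t2 ^+ s.+1)) *: a r s.+1))).
    by rewrite -!mul_polyC !(polyCM, polyC_exp); ring.
  by rewrite esym_empty_rec; congr (_ *: _); ring.
rewrite esym_rec addrAC subrr add0r.
by rewrite -!mul_polyC !(polyCM, polyC_exp); ring.
Qed.

Let Z := Zser q u [::] [::].
Let act (f : {poly K}) : nat -> K := fps_mul (fun i => f`_i) Z.

Lemma actB f g n : act (f - g) n = act f n - act g n.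
Proof. by rewrite -sumrB; apply: eq_bigr => i _; rewrite coefB mulrBl. Qed.

Lemma actD f g n : act (f + g) n = act f n + act g n.
Proof. by rewrite -big_split; apply: eq_bigr => i _; rewrite coefD mulrDl. Qed.

Lemma actZ c f n : act (c *: f) n = c * act f n.
Proof. by rewrite mulr_sumr; apply: eq_bigr => i _; rewrite coefZ mulrA. Qed.

Lemma actX f n : act ('X * f) n = if n is n'.+1 then act f n' else 0.
Proof.
rewrite /act /fps_mul big_ord_recl coefXM mul0r add0r.
case: n => [|n]; first by rewrite big_ord0.
by apply: eq_bigr => i _; rewrite coefXM.
Qed.

Lemma shift_coef_neq0 r : u * (t2 - t2 ^- r) != 0.
Proof.
rewrite mulf_neq0 // subr_eq0; apply/eqP => E.
have : t2 ^+ r.+1 = 1 by rewrite exprS {1}E mulVf // expf_neq0 // t2_neq0.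
move/(congr1 GRing.inv); rewrite invr1 /t2 exprVn invrK -exprM => /eqP.
by apply/negP; exact: expu_neq1 qu_generic _ _.
Qed.

Lemma Zser_colC r s n :
  Zser q u (col_part r) (col_part s) n = Zser q u (col_part s) (col_part r) n.
Proof.
by apply: eq_bigr => eta _; rewrite [schur_spec q u (col_part r) _ * _]mulrC.
Qed.

Lemma Zser_quotient r s n :
  Zser q u (col_part r) (col_part s) n = act (P r s) n.
Proof.
elim: r s n => [|r IHr] s n.
  elim: s n => [|s IHs] n.
    rewrite /act /P /quotient_poly !esym_Q0 mulr1 /gcol !expr0 invr1 !mulr1 scale1r.
    rewrite -[LHS](fps_mulr1 Z) fps_mulC.
    by apply: eq_fps_mul => // i; rewrite coef1.
  apply: (mulfI (shift_coef_neq0 s)).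
  have EZ := Zser1_rec charK0 q_neq0 u_neq0 qu_generic s n.
  have EP : act ((u * (t2 - t2 ^- s)) *: P 0 s.+1 + P 0 s) n =
      act (t2 ^+ s *: ('X * P 0 s)) n by rewrite quotient_poly_rec1.
  rewrite actD (actZ _ (P 0 s.+1)) (actZ _ ('X * _)) actX in EP.
  apply: (addIr (act (P 0 s) n)); rewrite EP -IHs !(Zser_colC 0) -EZ.
  by case: (n) => [|m]; rewrite ?mulr0 // -IHs Zser_colC.
(* [IHr] holds for every second index, so the term with [s.+1] in [Zser2_rec] is known and the
   relation determines the value at [r.+1]. *)
apply: (mulfI (shift_coef_neq0 r)).
have EZ := Zser2_rec charK0 q_neq0 u_neq0 qu_generic r s n.
have EP : act ((u * (t2 - t2 ^- r)) *: P r.+1 s - (u * (t2 - t2 ^- s)) *: P r s.+1) n =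
    act ((q * (t2 ^+ r - t2 ^+ s)) *: ('X * P r s)) n by rewrite quotient_poly_rec2.
rewrite actB (actZ _ (P r.+1 s)) (actZ _ (P r s.+1)) (actZ _ ('X * _)) actX in EP.
apply: (addIr (- (u * (t2 - t2 ^- s) * act (P r s.+1) n))).
rewrite EP -IHr -!mulrA -mulrBr -EZ.
by case: (n) => [|m]; rewrite ?mulr0 // -IHr ?mulrA.
Qed.

Lemma fps_div_quotient r s n :
  fps_div (Zser q u (col_part r) (col_part s)) Z n = (P r s)`_n.
Proof.
have Z0 : Z 0%N != 0 by rewrite /Z Zser_vac0 oner_neq0.
rewrite /fps_div (eq_fps_mul (Zser_quotient r s) (frefl _)) -fps_mulA.
rewrite (eq_fps_mul (frefl _) (fps_mulV Z0)).
exact: fps_mulr1.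
Qed.

Lemma t2_pow_neq1 s : 1 - t2 ^+ s.+1 != 0.
Proof.
have := shift_coef_neq0 s; apply: contra => /eqP; rewrite exprS => E.
rewrite mulf_eq0 subr_eq0 (negPf u_neq0) /=; apply/eqP.
have := t2_neq0 u_neq0; rewrite -/t2 => t2n.
apply: (mulIf (expf_neq0 s t2n)); rewrite mulVf ?expf_neq0 //.
by apply/eqP; rewrite eq_sym -subr_eq0 E.
Qed.

Lemma size_esym_empty s : size (a 0 s) = s.+1.
Proof.
elim: s => [|s IHs]; first by rewrite esym_Q0 size_poly1.
have u1 : u * (1 - t2 ^+ s.+1) != 0 by rewrite mulf_neq0 ?t2_pow_neq1.
rewrite -(size_scale _ u1) esym_empty_rec.
have szl : size (t2 ^+ s *: 'X - 1 : {poly K}) = 2.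
  rewrite size_polyDl size_scale ?size_polyX ?expf_neq0 ?t2_neq0 //.
  by rewrite size_polyN size_poly1.
by rewrite size_mul ?szl ?IHs // -size_poly_gt0 ?szl ?IHs.
Qed.

Lemma coef_esym_shift r s j : (a r.+1 s.+1)`_j.+1 =
  t2 ^+ s.+1 * (a r s.+1)`_j.+1 + q * (u^-1 * t2 ^+ s * (a r s)`_j)
  - u^-1 * (a r.+1 s)`_j.+1.
Proof.
have := congr1 (fun f : {poly K} => f`_j.+1) (esym_shift r s).
rewrite -!polyC_exp -scalerAl mulrCA !coefD !coefCM coefZ coefCM coefXM /= => E.
by rewrite -[LHS](addrK (u^-1 * (a r.+1 s)`_j.+1)) E; congr (_ + _ - _); ring.
Qed.

Lemma coef_esym_gt r s j : (s < j)%N -> (a r s)`_j = 0.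
Proof.
elim: r s j => [|r IHr] s j; first by move=> sj; rewrite nth_default ?size_esym_empty.
elim: s j => [|s IHs] [|j] // sj; first by rewrite esym_Q0 coef1.
rewrite coef_esym_shift IHs ?IHr ?mulr0 ?addr0 ?subr0 //; exact: ltnW.
Qed.

(** In the top degree the last term of [coef_esym_shift] vanishes, leaving a recursion among leading
    coefficients whose second term is a multiple of [q]. *)
Lemma coef_esym_diag r s : (a r.+1 s.+1)`_s.+1 =
  t2 ^+ s.+1 * (a r s.+1)`_s.+1 + q * (u^-1 * t2 ^+ s * (a r s)`_s).
Proof. by rewrite coef_esym_shift (@coef_esym_gt r.+1 s s.+1) // mulr0 subr0. Qed.

Lemma coef_esym_empty_diag s :
  u * (1 - t2 ^+ s.+1) * (a 0 s.+1)`_s.+1 = t2 ^+ s * (a 0 s)`_s.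
Proof.
have := congr1 (fun f : {poly K} => f`_s.+1) (esym_empty_rec s).
rewrite mulrBl mul1r -scalerAl coefB !coefZ coefXM /= => ->.
by rewrite (@coef_esym_gt 0 s s.+1) // subr0.
Qed.

Lemma size_quotient_poly r s :
  (a r s)`_s != 0 -> size (quotient_poly r s) = (r + s).+1.
Proof.
move=> as0; rewrite size_scale ?(mulf_neq0 (gcol_neq0 r) (gcol_neq0 s)) //.
have sz : size (a r s) = s.+1.
  apply/eqP; rewrite eqn_leq; apply/andP; split.
    by apply/leq_sizeP => j; exact: coef_esym_gt.
  by rewrite ltnNge; apply: contra as0 => /leq_sizeP/(_ s (leqnn s)) ->.
have ar0 : a r s != 0 by rewrite -size_poly_gt0 sz.
have a00 : a 0 r != 0 by rewrite -size_poly_gt0 size_esym_empty.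
by rewrite size_mul // sz size_esym_empty addSn addnS.
Qed.

(** [U] abstracts being a unit of the local ring at [q = 0]; the recursions for the leading
    coefficients never leave it. *)
Lemma coef_esym_diag_neq0 (U : K -> Prop) r s :
  U 1 -> U u -> (forall x, U x -> x != 0) -> (forall x, U x -> U x^-1) ->
  (forall x y, U x -> U y -> U (x * y)) ->
  (forall x y, U x -> U y -> U (x + q * y)) ->
  (forall n, U (1 - t2 ^+ n.+1)) -> (a r s)`_s != 0.
Proof.
move=> U1 Uu U_neq0 UV UM UD Ut; apply: (U_neq0).
have UX x n : U x -> U (x ^+ n).
  by move=> Ux; elim: n => [|n IHn]; rewrite ?expr0 // exprS; apply: UM.
have Ut2 n : U (t2 ^+ n) by apply: (UX); apply: (UV); apply: UX.
elim: r s => [|r IHr] s; last first.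
  case: s => [|s]; first by rewrite esym_Q0 coef1.
  by rewrite coef_esym_diag; apply: (UD); do ?apply: (UM); auto.
elim: s => [|s IHs]; first by rewrite esym_Q0 coef1.
have Uc : U (u * (1 - t2 ^+ s.+1)) by apply: UM.
rewrite -[_`_ _](mulKf (U_neq0 _ Uc)) coef_esym_empty_diag.
by apply: (UM); [apply: UV | apply: UM].
Qed.

End QuotientPolynomial.

(** * Rational functions in two indeterminates and evaluation at [q = 0] *)

Lemma monomial_int_inj (K : fieldType) (q u : K) :
  q != 0 -> u != 0 ->
  (forall m m' n n' : nat,
     q ^+ m * u ^+ m' = q ^+ n * u ^+ n' -> m = n /\ m' = n') ->
  forall a b : int, q ^ a * u ^ b = 1 -> a = 0 /\ b = 0.
Proof.
move=> q0 u0 nat_inj a b.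
have intE (c : int) : exists m n : nat, c = m%:Z - n%:Z.
  by case: c => n; [exists n, 0%N | exists 0%N, n.+1]; rewrite ?subr0 ?sub0r.
have [m [n ->]] := intE a; have [m' [n' ->]] := intE b.
rewrite !expfzDr // -!exprnN -!exprnP => E.
have /nat_inj[-> ->] : q ^+ m * u ^+ m' = q ^+ n * u ^+ n'.
  transitivity ((q ^+ m / q ^+ n) * (u ^+ m' / u ^+ n') * (q ^+ n * u ^+ n')).
    by field; rewrite !expf_neq0.
  by rewrite E mul1r.
by rewrite !subrr.
Qed.

Section RationalFunctions.
Variable F : fieldType.
Hypothesis charF0 : [pchar F] =i pred0.
Let q := q_ind F.
Let u := thalf_ind F.

Lemma q_ind_neq0 : q != 0.
Proof. by rewrite tofrac_eq0 polyC_eq0 polyX_eq0. Qed.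

Lemma thalf_ind_neq0 : u != 0.
Proof. by rewrite tofrac_eq0 polyX_eq0. Qed.

Lemma pchar_ratfun : [pchar (ratfun F)] =i pred0.
Proof.
apply/pcharf0P => n; rewrite -tofrac1 -tofracMn tofrac_eq0 -!polyC1 -!polyCMn.
rewrite !polyC_eq0; by have /pcharf0P -> := charF0.
Qed.

(** Degrees in the outer variable give [b = b']; comparing leading coefficients then gives
    [a = a']. *)
Lemma monomial_nat_inj (a b a' b' : nat) :
  q ^+ a * u ^+ b = q ^+ a' * u ^+ b' -> a = a' /\ b = b'.
Proof.
rewrite /q /u /q_ind /thalf_ind -!tofracXn -!tofracM => /eqP.
rewrite tofrac_eq -!polyC_exp => /eqP E.
have sz c d : size (('X^c : {poly F})%:P * 'X^d) = d.+1.
  by rewrite size_Cmul ?size_polyXn // -size_poly_eq0 size_polyXn.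
have bb' : b = b'.
  by have := congr1 (fun f : {poly {poly F}} => size f) E; rewrite !sz => -[].
split=> //; have := congr1 (fun f : {poly {poly F}} => f`_b) E.
rewrite bb' !coefCM coefXn eqxx !mulr1.
by move/(congr1 (fun f : {poly F} => size f)); rewrite !size_polyXn => -[].
Qed.

Lemma ratfun_generic (a b : int) : q ^ a * u ^ b = 1 -> a = 0 /\ b = 0.
Proof.
exact: (monomial_int_inj q_ind_neq0 thalf_ind_neq0 monomial_nat_inj).
Qed.

(** Sets [q], the inner variable, to 0. *)
Let ev : {poly {poly F}} -> {poly F} := map_poly (horner_eval 0).

Definition unit_at_q0 (x : ratfun F) : Prop :=
  exists n d, [/\ ev n != 0, ev d != 0 & x = tofrac n / tofrac d].

Lemma ev_tofrac_neq0 n : ev n != 0 -> tofrac n != 0 :> ratfun F.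
Proof. by rewrite tofrac_eq0; apply: contra => /eqP ->; rewrite /ev rmorph0. Qed.

Lemma coef_esym_ratfun_neq0 r s : (esym_Q q u s (col_part r))`_s != 0.
Proof.
have uE n : u ^+ n = tofrac 'X^n by rewrite tofracXn.
apply: (@coef_esym_diag_neq0 _ _ _ pchar_ratfun q_ind_neq0 thalf_ind_neq0
  ratfun_generic unit_at_q0).
- by exists 1, 1; rewrite /ev rmorph1 tofrac1 divr1 oner_neq0.
- exists 'X, 1; rewrite /ev rmorph1 tofrac1 divr1 oner_neq0 map_polyX.
  by rewrite polyX_eq0.
- move=> _ [n [d [n0 d0 ->]]].
  by rewrite mulf_neq0 ?invr_neq0 ?ev_tofrac_neq0.
- by move=> _ [n [d [n0 d0 ->]]]; exists d, n; rewrite invf_div.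
- move=> _ _ [n [d [n0 d0 ->]]] [n' [d' [n'0 d'0 ->]]]; exists (n * n'), (d * d').
  by split; rewrite ?tofracM ?mulf_div // /ev rmorphM mulf_neq0.
- move=> _ _ [n [d [n0 d0 ->]]] [n' [d' [n'0 d'0 ->]]].
  (* At [q = 0] the second term of this numerator vanishes. *)
  exists (n * d' + ('X%:P * n') * d), (d * d'); split.
  + rewrite /ev rmorphD !rmorphM /= map_polyC /= /horner_eval hornerX !mul0r addr0.
    exact: mulf_neq0.
  + by rewrite /ev rmorphM mulf_neq0.
  by rewrite mulrA addf_div ?ev_tofrac_neq0 // tofracD !tofracM.
- move=> n; exists ('X^(2 * n.+1) - 1), 'X^(2 * n.+1).
  have evX m : ev 'X^m = 'X^m by rewrite /ev rmorphXn /= map_polyX.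
  split.
  + rewrite /ev rmorphB rmorph1 [X in X - _]evX -size_poly_eq0.
    by rewrite size_XnsubC ?muln_gt0.
  + by rewrite evX -size_poly_eq0 size_polyXn.
  rewrite tofracB tofrac1 -!uE mulrBl mul1r mulfV ?expf_neq0 ?thalf_ind_neq0 //.
  by rewrite exprVn -exprM.
Qed.

End RationalFunctions.

Theorem proposition4p5 (F : fieldType) (charF0 : [pchar F] =i pred0) (r s : nat) :
  let q := q_ind F in
  let u := thalf_ind F in
  let P : {poly ratfun F} :=
    (gcol u r * gcol u s) *:
      (esym_Q q u r [::] * esym_Q q u s (col_part r)) in
  (forall n : nat,
     fps_div (Zser q u (col_part r) (col_part s)) (Zser q u [::] [::]) n = P`_n)
  /\ size P = (r + s).+1.
Proof.
move=> q u P; split.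
  exact: (fps_div_quotient (pchar_ratfun charF0) (q_ind_neq0 F)
    (thalf_ind_neq0 F) (@ratfun_generic F)).
apply: (size_quotient_poly (pchar_ratfun charF0) (q_ind_neq0 F)
    (thalf_ind_neq0 F) (@ratfun_generic F)).
exact: coef_esym_ratfun_neq0.
Qed.
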